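(* The total space of a nontrivial homogeneous $\mathbb{G}_a$-bundle $\rho:X\to\mathbb{A}^2_*$ of degree $-d<-2$ is not isomorphic (as an algebraic variety) to $X_{1,1}=\{xv-yu=1\}\simeq\mathrm{SL}_2(\mathbb{C})$.
   Context: Everything is over $\mathbb{C}$. $\mathbb{A}^2_*=\mathrm{Spec}(\mathbb{C}[x,y])\setminus\{(0,0)\}$. A $\mathbb{G}_a$-bundle over $\mathbb{A}^2_*$ is a Zariski locally trivial principal $\mathbb{G}_a$-bundle $\rho:X\to\mathbb{A}^2_*$; isomorphism classes of these are in bijection with $H^1(\mathbb{A}^2_*,\mathcal{O}_{\mathbb{A}^2_*})$, the trivial bundle corresponding to $0$. Let $\pi:\mathbb{A}^2_*\to\mathbb{P}^1$ be the quotient morphism for the $\mathbb{G}_m$-action $\lambda\cdot(x,y)=(\lambda x,\lambda y)$. Since $\pi$ is affine and $\pi_*\mathcal{O}_{\mathbb{A}^2_*}\simeq\bigoplus_{d\in\mathbb{Z}}\mathcal{O}_{\mathbb{P}^1}(-d)$, one has $H^1(\mathbb{A}^2_*,\mathcal{O}_{\mathbb{A}^2_*})\simeq\bigoplus_{d\geq 2}H^1(\mathbb{P}^1,\mathcal{O}_{\mathbb{P}^1}(-d))$. A nontrivial $\mathbb{G}_a$-bundle $\rho:X\to\mathbb{A}^2_*$ is called homogeneous of degree $-d$, $d\geq 2$, if its class lies in the summand $H^1(\mathbb{P}^1,\mathcal{O}_{\mathbb{P}^1}(-d))$. Here $X_{1,1}=\{xv-yu=1\}\subset\mathbb{A}^4=\mathrm{Spec}(\mathbb{C}[x,y,u,v])$.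 *)

(* Defs.v *)
From HB Require Import structures.
From mathcomp Require Import all_boot all_order all_algebra.
From mathcomp Require Import mpoly.
From mathcomp Require Import boolp classical_sets functions filter reals.
From mathcomp Require Import topology_structure.
From mathcomp Require Import complex.

Set Implicit Arguments.
Unset Strict Implicit.
Unset Printing Implicit Defensive.

Import GRing.Theory.
Local Open Scope ring_scope.
Local Open Scope classical_set_scope.

(* Varieties over an algebraically closed field k are treated classically, as
   spaces of closed points carrying a sheaf of k-valued functions.  Functions
   and maps are total Rocq functions; a property "on U" only constrains their
   values on the open set U (see regular_eq). *)
Record fun_space (k : closedFieldType) := FunSpace {
  point :> topologicalType;
  regular : set point -> (point -> k) -> Prop;
  regular_eq : forall U f g, open U -> (forall x, U x -> f x = g x) ->
    regular U f -> regular U g;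
  regular_bigcup : forall (I : Type) (U : I -> set point) f,
    (forall i, open (U i)) ->
    (regular (\bigcup_i U i) f <-> forall i, regular (U i) f);
  regular_cst : forall U c, open U -> regular U (fun=> c);
  regularD : forall U f g, open U -> regular U f -> regular U g ->
    regular U (fun x => f x + g x);
  regularM : forall U f g, open U -> regular U f -> regular U g ->
    regular U (fun x => f x * g x);
  regularV : forall U f, open U -> regular U f ->
    open (U `&` [set x | f x != 0]) /\
    regular (U `&` [set x | f x != 0]) (fun x => (f x)^-1)
}.

(* Morphism U -> Y, where U is an open subspace of X. *)
Definition morphism_on (k : closedFieldType) (X Y : fun_space k)
    (U : set X) (phi : X -> Y) : Prop :=
  forall V : set Y, open V ->
    open (U `&` phi @^-1` V) /\
    forall f, regular V f -> regular (U `&` phi @^-1` V) (f \o phi).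

Definition isomorphic (k : closedFieldType) (X Y : fun_space k) : Prop :=
  exists (phi : X -> Y) (psi : Y -> X),
    [/\ morphism_on setT phi, morphism_on setT psi,
        cancel phi psi & cancel psi phi].

(* A subset A of affine n-space k^n with the Zariski topology and the sheaf of
   regular functions: locally, quotients of polynomials.  The alias keeps the
   type apart from set_type A, which may carry another topology. *)
Definition affine_sub (k : closedFieldType) (n : nat) (A : set 'rV[k]_n) :=
  set_type A.

Definition peval (k : closedFieldType) (n : nat) (A : set 'rV[k]_n)
    (p : {mpoly k[n]}) (x : affine_sub A) : k :=
  p.@[fun i => val x 0 i].

Definition zariski_open (k : closedFieldType) (n : nat) (A : set 'rV[k]_n)
    (U : set (affine_sub A)) : Prop :=
  forall x, U x -> exists p : {mpoly k[n]},
    peval p x != 0 /\ forall y : affine_sub A, peval p y != 0 -> U y.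

(* Stated for an abstract T: on affine_sub, the search for a Filter instance
   would unfold nbhs. *)
Local Lemma nbhsI (T : topologicalType) (x : T) (P Q : set T) :
  nbhs x P -> nbhs x Q -> nbhs x (P `&` Q).
Proof. exact: filterI. Qed.

Local Lemma nbhs_sub (T : topologicalType) (x : T) (P Q : set T) :
  nbhs x P -> (forall y, P y -> Q y) -> nbhs x Q.
Proof. by move=> xP PQ; apply: filterS xP. Qed.

Local Lemma nbhsW (T : topologicalType) (x : T) (P : set T) :
  (forall y, P y) -> nbhs x P.
Proof. exact: nearW. Qed.

Section AffineSub.
Variables (k : closedFieldType) (n : nat) (A : set 'rV[k]_n).

HB.instance Definition _ := Choice.copy (affine_sub A) (set_type A).

Let zariski_openT : zariski_open [set: affine_sub A].
Proof. by move=> x _; exists 1; split=> //; rewrite /peval meval1 oner_neq0. Qed.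

Let zariski_openI : setI_closed (@zariski_open k n A).
Proof.
move=> U V oU oV x [/oU[p [px pU]] /oV[q [qx qV]]]; exists (p * q).
rewrite /peval mevalM mulf_neq0//; split=> // y; rewrite mevalM mulf_eq0 negb_or.
by move=> /andP[/pU Uy /qV Vy].
Qed.

Let zariski_open_bigcup (I : Type) (U : I -> set (affine_sub A)) :
  (forall i, zariski_open (U i)) -> zariski_open (\bigcup_i U i).
Proof.
by move=> oU x [i _ /oU[p [px pU]]]; exists p; split=> // y /pU Uy; exists i.
Qed.

HB.instance Definition _ := isOpenTopological.Build (affine_sub A)
  zariski_openT zariski_openI zariski_open_bigcup.

Lemma openE_zariski (U : set (affine_sub A)) : open U = zariski_open U.
Proof. by []. Qed.

Definition sub_regular (U : set (affine_sub A)) (f : affine_sub A -> k) : Prop :=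
  forall x, U x -> exists p q : {mpoly k[n]}, \forall y \near x,
    peval q y != 0 /\ f y = peval p y / peval q y.

Let sub_regular_eq U f g : open U -> (forall x, U x -> f x = g x) ->
  sub_regular U f -> sub_regular U g.
Proof.
move=> oU fg rf x Ux; have [p [q pq]] := rf x Ux; exists p, q.
have nU : nbhs x U by exact: open_nbhs_nbhs.
by apply: (nbhs_sub (nbhsI nU pq)) => y [Uy []] ? <-; rewrite fg.
Qed.

Let sub_regular_bigcup (I : Type) (U : I -> set (affine_sub A)) f :
  (forall i, open (U i)) ->
  (sub_regular (\bigcup_i U i) f <-> forall i, sub_regular (U i) f).
Proof.
move=> _; split=> [rf i x Ux | rf x [i _ Ux]]; last exact: rf Ux.
by apply: rf; exists i.
Qed.

Let sub_regular_cst U (c : k) : open U -> sub_regular U (fun=> c).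
Proof.
move=> _ x _; exists c%:MP, 1; apply: nbhsW => y.
by rewrite /peval meval1 mevalC oner_neq0 divr1.
Qed.

Let sub_regularD U f g : open U -> sub_regular U f -> sub_regular U g ->
  sub_regular U (fun x => f x + g x).
Proof.
move=> _ rf rg x Ux; have [p [q pq]] := rf x Ux; have [r [s rs]] := rg x Ux.
exists (p * s + r * q), (q * s).
apply: (nbhs_sub (nbhsI pq rs)) => y [[q0 ->] [s0 ->]].
by rewrite /peval mevalD !mevalM addf_div ?mulf_neq0.
Qed.

Let sub_regularM U f g : open U -> sub_regular U f -> sub_regular U g ->
  sub_regular U (fun x => f x * g x).
Proof.
move=> _ rf rg x Ux; have [p [q pq]] := rf x Ux; have [r [s rs]] := rg x Ux.
exists (p * r), (q * s).
apply: (nbhs_sub (nbhsI pq rs)) => y [[q0 ->] [s0 ->]].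
by rewrite /peval !mevalM mulf_neq0// mulf_div.
Qed.

Let open_peval_neq0 (p : {mpoly k[n]}) :
  open [set x : affine_sub A | peval p x != 0].
Proof. by move=> x px; exists p. Qed.

Let sub_regularV U f : open U -> sub_regular U f ->
  open (U `&` [set x | f x != 0]) /\
  sub_regular (U `&` [set x | f x != 0]) (fun x => (f x)^-1).
Proof.
move=> oU rf.
suff H x : U x -> f x != 0 -> exists p q : {mpoly k[n]}, \forall y \near x,
    [/\ U y, peval p y != 0, peval q y != 0 & f y = peval p y / peval q y].
  split.
    rewrite openE => x [Ux fx]; have [p [q pq]] := H x Ux fx.
    apply: (nbhs_sub pq) => y [Uy p0 q0 fy]; split=> //=.
    by rewrite fy mulf_neq0// invr_eq0.
  move=> x [Ux fx]; have [p [q pq]] := H x Ux fx; exists q, p.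
  by apply: (nbhs_sub pq) => y [_ p0 q0 ->]; rewrite invf_div.
move=> Ux fx; have [p [q pq]] := rf x Ux; exists p, q.
have px : peval p x != 0.
  have [_ fxE] := nbhs_singleton pq; apply: contraNneq fx => px.
  by rewrite fxE px mul0r.
have np : nbhs x [set y | peval p y != 0].
  by apply: open_nbhs_nbhs; split=> //; exact: open_peval_neq0.
have nU : nbhs x U by exact: open_nbhs_nbhs.
by apply: (nbhs_sub (nbhsI nU (nbhsI np pq))) => y [Uy [py [qy fy]]].
Qed.

Definition sub_space : fun_space k :=
  FunSpace sub_regular_eq sub_regular_bigcup sub_regular_cst
    sub_regularD sub_regularM sub_regularV.

End AffineSub.
Arguments sub_space {k n} A.

(* A x A^1 inside affine (n+1)-space; the last coordinate is that of A^1. *)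
Definition cylinder (k : closedFieldType) (n : nat) (A : set 'rV[k]_n) :
  set 'rV[k]_(n + 1) := [set v | A (lsubmx v)].

Definition cyl_base (k : closedFieldType) (n : nat) (A : set 'rV[k]_n)
    (z : sub_space (cylinder A)) : 'rV[k]_n := lsubmx (val z).

Definition cyl_fiber (k : closedFieldType) (n : nat) (A : set 'rV[k]_n)
    (z : sub_space (cylinder A)) : k := rsubmx (val z) 0 0.

(* Over the open set U, an equivariant isomorphism Phi over U between the
   G_a-space rho : X -> A and U x A^1, G_a acting by translations on A^1. *)
Definition trivial_over (k : closedFieldType) (n : nat) (A : set 'rV[k]_n)
    (X : fun_space k) (rho : X -> sub_space A) (act : k -> X -> X)
    (U : set (sub_space A)) : Prop :=
  exists (Phi : X -> sub_space (cylinder A)) (Psi : sub_space (cylinder A) -> X),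
    let XU := rho @^-1` U in
    let CU := [set z | exists2 b, U b & val b = cyl_base z] in
    [/\ morphism_on XU Phi /\ morphism_on CU Psi,
        (forall x, XU x -> CU (Phi x) /\ Psi (Phi x) = x) /\
        (forall z, CU z -> XU (Psi z) /\ Phi (Psi z) = z),
        forall x, XU x -> cyl_base (Phi x) = val (rho x) &
        forall a x, XU x -> cyl_fiber (Phi (act a x)) = a + cyl_fiber (Phi x)].

(* Zariski locally trivial principal G_a-bundles over A.  Local triviality
   makes the total space a variety and G_a x X -> X a morphism. *)
Record Ga_bundle (k : closedFieldType) (n : nat) (A : set 'rV[k]_n) := GaBundle {
  total_space : fun_space k;
  bundle_proj : total_space -> sub_space A;
  Ga_act : k -> total_space -> total_space;
  proj_morphism : morphism_on setT bundle_proj;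
  Ga_act0 : forall x, Ga_act 0 x = x;
  Ga_actD : forall a b x, Ga_act (a + b) x = Ga_act a (Ga_act b x);
  proj_Ga_act : forall a x, bundle_proj (Ga_act a x) = bundle_proj x;
  locally_trivial : forall b, exists U,
    [/\ open U, U b & trivial_over bundle_proj Ga_act U]
}.

Definition trivial_bundle (k : closedFieldType) (n : nat) (A : set 'rV[k]_n)
    (P : Ga_bundle A) : Prop :=
  trivial_over (@bundle_proj _ _ _ P) (@Ga_act _ _ _ P) setT.

Definition section_on (k : closedFieldType) (n : nat) (A : set 'rV[k]_n)
    (P : Ga_bundle A) (U : set (sub_space A))
    (s : sub_space A -> total_space P) : Prop :=
  morphism_on U s /\ forall b, U b -> bundle_proj (s b) = b.

Definition open_cover (k : closedFieldType) (B : fun_space k) (I : Type)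
    (U : I -> set B) : Prop :=
  (forall i, open (U i)) /\ forall b, exists i, U i b.

(* Cech 1-cocycle with values in the structure sheaf O_B. *)
Definition cech_cocycle (k : closedFieldType) (B : fun_space k) (I : Type)
    (U : I -> set B) (g : I -> I -> B -> k) : Prop :=
  (forall i j, regular (U i `&` U j) (g i j)) /\
  forall i j l b, U i b -> U j b -> U l b -> g i j b + g j l b = g i l b.

(* The class of P in H^1(A, O_A) is that of the cocycle g on the cover U. *)
Definition represented_by (k : closedFieldType) (n : nat) (A : set 'rV[k]_n)
    (P : Ga_bundle A) (I : Type) (U : I -> set (sub_space A))
    (g : I -> I -> sub_space A -> k) : Prop :=
  exists s : I -> sub_space A -> total_space P,
    (forall i, section_on (U i) (s i)) /\
    forall i j b, U i b -> U j b -> Ga_act (g i j b) (s i b) = s j b.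

Definition A2star (k : closedFieldType) : set 'rV[k]_2 := [set v | v != 0].
Arguments A2star k : clear implicits.

Definition SL2_eq (k : closedFieldType) : set 'rV[k]_4 :=
  [set w | let x := w 0 (inord 0) in let y := w 0 (inord 1) in
           let u := w 0 (inord 2) in let v := w 0 (inord 3) in
           x * v - y * u = 1].

Definition X11 (k : closedFieldType) : fun_space k := sub_space (@SL2_eq k).
Arguments X11 k : clear implicits.

(* U is the inverse image under pi of a subset of P^1 (open in P^1 iff U is
   open): stability under lambda.(x,y) = (lambda x, lambda y). *)
Definition Gm_stable (k : closedFieldType) (U : set (sub_space (A2star k))) : Prop :=
  forall (b c : sub_space (A2star k)) (lambda : k),
    lambda != 0 -> val c = lambda *: val b -> U b -> U c.

(* f is homogeneous of degree -d on the Gm-stable set U = pi^-1(V): if f is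
   regular, it is a section over V of the summand O(-d) of pi_* O. *)
Definition homogeneous_on (k : closedFieldType) (d : nat)
    (U : set (sub_space (A2star k))) (f : sub_space (A2star k) -> k) : Prop :=
  forall (b c : sub_space (A2star k)) (lambda : k),
    lambda != 0 -> val c = lambda *: val b -> U b -> f c = lambda ^- d * f b.

(* A cocycle on pi^-1(V_i), (V_i) an open cover of P^1, with entries
   homogeneous of degree -d is a cocycle of O(-d) on (V_i), and the resulting
   map H^1(P^1, O(-d)) -> H^1(A^2_*, O) is the inclusion of the summand. *)
Definition class_in_summand (k : closedFieldType) (d : nat)
    (P : Ga_bundle (A2star k)) : Prop :=
  exists (I : Type) (U : I -> set (sub_space (A2star k)))
    (g : I -> I -> sub_space (A2star k) -> k),
    [/\ open_cover U /\ (forall i, Gm_stable (U i)),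
        cech_cocycle U g,
        forall i j, homogeneous_on d (U i `&` U j) (g i j) &
        represented_by P U g].

Definition homogeneous_bundle (k : closedFieldType) (d : nat)
    (P : Ga_bundle (A2star k)) : Prop :=
  [/\ (2 <= d)%N, ~ trivial_bundle P & class_in_summand d P].

(* Main.v *)
Require Import Defs.
From mathcomp Require Import all_boot all_order all_algebra.
From mathcomp Require Import ring zify.
From mathcomp Require Import ssrcomplements mpoly.
From mathcomp Require Import boolp classical_sets functions cardinality filter.
From mathcomp Require Import topology_structure reals complex.
From mathcomp Require constructive_ereal lebesgue_measure.

Set Implicit Arguments.
Unset Strict Implicit.
Unset Printing Implicit Defensive.

Import Order.TTheory GRing.Theory Num.Theory.
Local Open Scope ring_scope.
Local Open Scope classical_set_scope.

(** The bundle and SL_2 are told apart by their volume forms.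

    On SL_2 a nowhere vanishing regular 3-form is unique up to a scalar, because
    the units of the coordinate ring are constants; it is the Haar form omega.
    This form is not exact: if e, f, h are the right-invariant vector fields of
    a basis of sl_2, an exact 3-form is (e a + f b + h c) omega with regular
    a, b, c, and the Haar integral of e a + f b + h c vanishes, so that
    this function is a nonzero constant for no a, b, c
    (SL2_no_constant_divergence).

    On the total space X of a bundle whose class is homogeneous of degree -d,
    let x, y be the coordinates of the base and t_i the fibre coordinate given
    by the i-th section of a representing cocycle g.  Then t_i = t_j + g_ij, so
    the forms dx /\ dy /\ dt_i are the restrictions of one nowhere vanishing
    3-form mu.  The vector field E with E x = x, E y = y, E t_i = - d t_i is
    well defined on X by Euler's identity x g_x + y g_y = - d g for the
    homogeneous functions g_ij, and the contraction of mu with E is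
      eta = x dy /\ dt_i - y dx /\ dt_i - d t_i dx /\ dy,
    with d eta = (2 - d) mu.  If X is isomorphic to SL_2, then mu is a nonzero
    multiple of omega, hence not exact, and d = 2 (degree_eq2).

    All this is carried out on SL_2 itself, to which x, y and the t_i are pulled
    back.  Three points need proof.
    - Regular functions are only locally quotients of polynomials; a vector
      field tangent to an affine set acts on them by the quotient rule
      (fun_deriv), with a chain rule along morphisms (fun_deriv_pullback).  The
      latter shows that dx /\ dy /\ dt_i vanishes nowhere, since the coordinates
      of SL_2 are locally rational functions of x, y, t_i.
    - A function that is regular on all of SL_2 is a polynomial
      (regular_everywhere_poly): its denominators generate the unit ideal by the
      Nullstellensatz, which is proved over an uncountable field by the
      dimension count of Amitsur.
    - The Haar integral is split into the average over the two-sided action of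
      the diagonal torus, which turns a polynomial function on SL_2 into a
      polynomial in z = y u (torus_average), and the integral of the latter over
      -1 <= z <= 0. *)

(** * Derivations of polynomial rings *)

Section PolynomialDerivations.
Variables (k : comNzRingType) (n : nat).
Implicit Types p q : {mpoly k[n]}.

Lemma mpoly_subring_ind (C : {mpoly k[n]} -> Prop) :
  (forall c, C c%:MP) -> (forall i, C 'X_i) ->
  (forall p q, C p -> C q -> C (p + q)) ->
  (forall p q, C p -> C q -> C (p * q)) -> forall p, C p.
Proof.
move=> CC CX CD CM; elim/mpolyind => [|c m p _ _ Cp]; first exact: (CC 0).
apply: (CD) => //; rewrite -mul_mpolyC; apply: (CM) => //.
rewrite mpolyXE_id; elim/big_ind: _ => [||i _]; [exact: (CC 1)|exact: CM|].
by elim: (m i) => [|j IH]; [exact: (CC 1)|rewrite exprS; exact: CM].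
Qed.

Lemma mderivXU (i j : 'I_n) : 'X_j^`M(i) = (i == j)%:R :> {mpoly k[n]}.
Proof.
rewrite mderivX mnm1E eq_sym; case: eqP => [->|_]; last by rewrite scale0r.
have -> : (U_(j) - U_(j) = 0 :> 'X_{1..n})%MM.
  by apply/mnmP => l; rewrite mnmBE mnm0E subnn.
by rewrite scale1r mpolyX0.
Qed.

(** Derivations along an arbitrary map phi, so as to cover derivations of the
    polynomial ring (phi = id), partial derivatives at a point and chain rules
    (phi an evaluation). *)
Lemma derivation_mpolyE (S : comNzRingType) (phi : {mpoly k[n]} -> S)
    (delta : {mpoly k[n]} -> S) :
  {morph phi : p q / p + q} -> {morph phi : p q / p * q} ->
  {morph delta : p q / p + q} -> (forall c, delta c%:MP = 0) ->
  (forall p q, delta (p * q) = delta p * phi q + phi p * delta q) ->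
  forall p, delta p = \sum_i delta 'X_i * phi p^`M(i).
Proof.
move=> phiD phiM dD dC dM.
have phi0 : phi 0 = 0 by apply: (addrI (phi 0)); rewrite -phiD !addr0.
have dp1 q : delta q = delta q * phi 1.
  have d1 : delta 1 = 0 by rewrite -(mpolyC1 n k) dC.
  by have := dM q 1; rewrite d1 mulr0 addr0 mulr1.
elim/mpoly_subring_ind => [c|j|p q IHp IHq|p q IHp IHq].
- rewrite dC big1// => i _; rewrite mderivC.
  by rewrite phi0 mulr0.
- rewrite (bigD1 j)//= big1 ?addr0 => [|i ij]; rewrite mderivXU.
    by rewrite eqxx -dp1.
  by rewrite (negPf ij) phi0 mulr0.
- rewrite dD IHp IHq -big_split/=; apply: eq_bigr => i _.
  by rewrite mderivD phiD mulrDr.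
- rewrite dM IHp IHq big_distrl big_distrr -big_split/=; apply: eq_bigr => i _.
  by rewrite mderivM phiD !phiM; ring.
Qed.

Definition field_deriv (v : 'I_n -> {mpoly k[n]}) p : {mpoly k[n]} :=
  \sum_i v i * p^`M(i).

Variable v : 'I_n -> {mpoly k[n]}.

Lemma field_derivD : {morph field_deriv v : p q / p + q}.
Proof.
move=> p q; rewrite /field_deriv -big_split/=; apply: eq_bigr => i _.
by rewrite mderivD mulrDr.
Qed.

Lemma field_derivC c : field_deriv v c%:MP = 0.
Proof. by rewrite /field_deriv big1// => i _; rewrite mderivC mulr0. Qed.

Lemma field_deriv0 : field_deriv v 0 = 0.
Proof. by rewrite -(mpolyC0 n k) field_derivC. Qed.

Lemma field_derivN : {morph field_deriv v : p / - p}.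
Proof.
move=> p; apply/eqP; rewrite -addr_eq0 -field_derivD addNr.
by rewrite field_deriv0.
Qed.

Lemma field_derivB : {morph field_deriv v : p q / p - q}.
Proof. by move=> p q; rewrite field_derivD field_derivN. Qed.

Lemma field_derivM p q :
  field_deriv v (p * q) = field_deriv v p * q + p * field_deriv v q.
Proof.
rewrite /field_deriv big_distrl big_distrr -big_split/=; apply: eq_bigr => i _.
by rewrite mderivM; ring.
Qed.

Lemma field_derivX i : field_deriv v 'X_i = v i.
Proof.
rewrite /field_deriv (bigD1 i)//= big1 ?addr0 => [|j ij]; rewrite mderivXU.
  by rewrite eqxx mulr1.
by rewrite (negPf ij) mulr0.
Qed.

Lemma field_derivZ c p : field_deriv v (c *: p) = c *: field_deriv v p.
Proof. by rewrite -!mul_mpolyC field_derivM field_derivC mul0r add0r. Qed.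

Lemma field_deriv_scale c p :
  field_deriv (fun i => c *: v i) p = c *: field_deriv v p.
Proof.
by rewrite /field_deriv scaler_sumr; apply: eq_bigr => i _; rewrite scalerAl.
Qed.

Lemma eq_field_deriv w p : v =1 w -> field_deriv v p = field_deriv w p.
Proof. by move=> vw; apply: eq_bigr => i _; rewrite vw. Qed.

End PolynomialDerivations.

(** Both sides are derivations that agree on the variables. *)
Lemma field_deriv_commutator (k : comNzRingType) n
    (v w : 'I_n -> {mpoly k[n]}) p :
  field_deriv v (field_deriv w p) - field_deriv w (field_deriv v p) =
  field_deriv (fun i => field_deriv v (w i) - field_deriv w (v i)) p.
Proof.
pose delta q :=
  field_deriv v (field_deriv w q) - field_deriv w (field_deriv v q).
rewrite -/(delta p) (@derivation_mpolyE _ _ _ id delta)//.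
- by apply: eq_bigr => i _; rewrite /delta !field_derivX.
- by move=> q r; rewrite /delta !field_derivD; ring.
- by move=> c; rewrite /delta !field_derivC ?field_deriv0 subrr.
- by move=> q r; rewrite /delta !(field_derivM, field_derivD); ring.
Qed.

(** * The Nullstellensatz over an uncountable field *)

(** The form in which uncountability is used: a map to nat is bounded on
    arbitrarily large finite sets. *)
Definition has_uncountable_fibres (k : Type) := forall D : k -> nat,
  exists m : nat, forall N : nat, exists a : 'I_N -> k,
    injective a /\ forall j, (D (a j) <= m)%N.

Section Nullstellensatz.
Variables (k : closedFieldType) (n : nat).
Implicit Types (p q : {mpoly k[n]}) (I : {mpoly k[n]} -> Prop).

Definition is_ideal I :=
  [/\ I 0, forall p q, I p -> I q -> I (p + q) & forall p q, I q -> I (p * q)].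

(** The ideal I + ('X_i - a). *)
Definition adjoin_linear I i (a : k) p :=
  exists q r, I q /\ p = q + r * ('X_i - a%:MP).

Lemma is_ideal_adjoin I i a : is_ideal I -> is_ideal (adjoin_linear I i a).
Proof.
move=> [I0 ID IM]; split.
- by exists 0, 0; split=> //; ring.
- move=> p q [p1 [r1 [Ip ->]]] [q1 [r2 [Iq ->]]].
  by exists (p1 + q1), (r1 + r2); split; [exact: ID|ring].
- move=> p q [q1 [r1 [Iq ->]]]; exists (p * q1), (p * r1).
  by split; [exact: IM|ring].
Qed.

Lemma bounded_mpoly_dependent m N (h : 'I_N -> {mpoly k[n]}) :
  (#|{: 'X_{1..n < m}}| < N)%N -> (forall j, msize (h j) <= m)%N ->
  exists c : 'I_N -> k, (exists j, c j != 0) /\ \sum_j c j *: h j = 0.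
Proof.
move=> ltN hm.
pose M := \matrix_(j < N, l < #|{: 'X_{1..n < m}}|) (h j)@_(enum_val l).
have rM : ~~ row_free M.
  by rewrite -row_leq_rank -ltnNge (leq_ltn_trans (rank_leq_col _)).
have [c c0 cM] : exists2 c : 'rV_N, c != 0 & c *m M = 0.
  by move: rM; rewrite -kermx_eq0 => /rowV0Pn[c /sub_kermxP cM c0]; exists c.
exists (c 0); split.
  by apply/existsP; apply: contraNT c0 => /existsPn c0; apply/eqP/rowP => j;
     rewrite mxE; apply/eqP/negPn/c0.
apply/mpolyP => mm; rewrite mcoeff0 raddf_sum/=.
under eq_bigr do rewrite mcoeffZ.
have [mmm|mmm] := leqP m (mdeg mm).
  rewrite big1// => j _; rewrite memN_msupp_eq0 ?mulr0//.
  by apply: msize_mdeg_ge; exact: leq_trans (hm j) mmm.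
have /rowP/(_ (enum_rank (BMultinom mmm))) := cM; rewrite !mxE => E.
by rewrite -[RHS]E; apply: eq_bigr => j _; rewrite mxE enum_rankK.
Qed.

(** Some 'X_i - a is not invertible modulo a proper ideal I.  Otherwise
    uncountably many inverses h_a would be given, and by counting dimensions a
    nontrivial relation sum_j c_j h_(a_j) = 0 between h_a of bounded degree.
    Multiplied by prod_j ('X_i - a_j), it puts into I a nonzero polynomial in
    'X_i; its linear factors are invertible modulo I, so I contains 1. *)
Lemma linear_factor_notunit I i : has_uncountable_fibres k -> is_ideal I ->
  (forall a, adjoin_linear I i a 1) -> I 1.
Proof.
move=> unc [I0 ID IM] H.
have inv a : exists h, I (1 - h * ('X_i - a%:MP)).
  by have [q [r [Iq E]]] := H a; exists r; rewrite E addrK.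
(* Factors 'X_i - a can be cancelled modulo I. *)
have IU p a : I (p * ('X_i - a%:MP)) -> I p.
  have [h Ih] := inv a => Ip.
  have -> : p = p * (1 - h * ('X_i - a%:MP)) + h * (p * ('X_i - a%:MP)) by ring.
  by apply: (ID); exact: IM.
have [h hP] := choice inv.
have [m /(_ #|{: 'X_{1..n < m}}|.+1)] := unc (fun a => msize (h a)).
set N := _.+1 => -[a [ainj am]].
have [c [[j0 cj0] ch]] :=
  @bounded_mpoly_dependent m N (fun j => h (a j)) (ltnSn _) am.
(* The relation cleared of denominators, as a polynomial in one variable. *)
pose F : {poly k} := \sum_j c j *: \prod_(l | l != j) ('X - (a l)%:P).
pose ev (p : {poly k}) : {mpoly k[n]} := (map_poly (@mpolyC n k) p).['X_i].
have evX a0 : ev ('X - a0%:P) = 'X_i - a0%:MP.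
  by rewrite /ev rmorphB/= map_polyX map_polyC/= hornerXsubC.
have evM (p q : {poly k}) : ev (p * q) = ev p * ev q.
  by rewrite /ev rmorphM/= hornerM.
have evC c0 : ev c0%:P = c0%:MP by rewrite /ev map_polyC/= hornerC.
have ev1 : ev 1 = 1 by rewrite -polyC1 evC mpolyC1.
have F0 : F != 0.
  apply/eqP => /(congr1 (horner^~ (a j0))); rewrite horner0 horner_sum.
  rewrite (bigD1 j0)//= [X in _ + X]big1 => [|j jj0].
    rewrite addr0 hornerZ horner_prod => /eqP; rewrite mulf_eq0 (negPf cj0)/=.
    move/eqP; apply/eqP; apply/prodf_neq0 => l lj0.
    rewrite hornerXsubC subr_eq0; by apply: contraNneq lj0 => /ainj->.
  rewrite hornerZ horner_prod (bigD1 j0) 1?eq_sym//= hornerXsubC subrr mul0r.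
  by rewrite mulr0.
have IN p : I p -> I (- p) by rewrite -mulN1r; exact: IM.
have Iev : I (ev F).
  have evsum (G : 'I_N -> {poly k}) : ev (\sum_j G j) = \sum_j ev (G j).
    by rewrite /ev rmorph_sum/= horner_sum.
  pose G := \prod_l ('X_i - (a l)%:MP).
  have -> : ev F = \sum_j (c j)%:MP *
      ((\prod_(l | l != j) ('X_i - (a l)%:MP)) *
       (1 - h (a j) * ('X_i - (a j)%:MP))).
    have G0 : \sum_j G * (c j *: h (a j)) = 0 by rewrite -big_distrr/= ch mulr0.
    rewrite evsum -[LHS]subr0 -[X in _ - X]G0 -sumrB.
    apply: eq_bigr => j _; rewrite -mul_polyC evM evC.
    have -> : ev (\prod_(l | l != j) ('X - (a l)%:P)) =
              \prod_(l | l != j) ('X_i - (a l)%:MP).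
      by rewrite (big_morph ev evM ev1); apply: eq_bigr => l _; rewrite evX.
    have -> : G = ('X_i - (a j)%:MP) * \prod_(l | l != j) ('X_i - (a l)%:MP).
      by rewrite /G (bigD1 j).
    rewrite -mul_mpolyC.
    set P := \prod_(l | _) _; ring.
  by elim/big_ind: _ => // j _; do 2 apply: (IM); exact: hP.
have [r rF] := closed_field_poly_normal F.
move: Iev; rewrite rF -mul_polyC evM evC.
have lF : lead_coef F != 0 by rewrite lead_coef_eq0.
move=> /(IM (lead_coef F)^-1%:MP); rewrite mulrA -mpolyCM mulVf// mpolyC1 mul1r.
elim: r {rF} => [|b r IHr]; first by rewrite big_nil ev1.
by rewrite big_cons evM evX mulrC => /IU.
Qed.

(** Linear polynomials 'X_i - a_i are adjoined to a proper ideal one variable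
    after the other; it stays proper, and every polynomial is then congruent to
    its value at a, so that a is a common zero. *)
Theorem weak_Nullstellensatz I : has_uncountable_fibres k -> is_ideal I ->
  (forall a : 'I_n -> k, exists2 p, I p & p.@[a] != 0) -> I 1.
Proof.
move=> unc idI noz; apply: contrapT => nI1.
have [J [a [idJ nJ1 IJ Ja]]] : exists J (a : 'I_n -> k),
    [/\ is_ideal J, ~ J 1, forall p, I p -> J p &
      forall i, i \in enum 'I_n -> J ('X_i - (a i)%:MP)].
  elim: (enum 'I_n) => [|i s [J [a [idJ nJ1 IJ Ja]]]].
    by exists I, (fun=> 0); split.
  have [b nJb] : exists b, ~ adjoin_linear J i b 1.
    by apply/existsNP => H; exact/nJ1/(linear_factor_notunit unc idJ H).
  have subJ p : J p -> adjoin_linear J i b p.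
    by move=> Jp; exists p, 0; split=> //; rewrite mul0r addr0.
  exists (adjoin_linear J i b), (fun l => if l == i then b else a l).
  split=> //.
  - exact: is_ideal_adjoin.
  - by move=> p /IJ/subJ.
  - move=> l; rewrite inE; case: eqP => [-> _|_ /= /Ja/subJ//].
    by exists 0, 1; split; [case: idJ|ring].
have [J0 JD JM] := idJ.
have Jev p : J (p - p.@[a]%:MP).
  elim/mpoly_subring_ind: p => [c|i|p q Jp Jq|p q Jp Jq].
  - by rewrite mevalC subrr.
  - by rewrite mevalXU; apply: Ja; rewrite mem_enum.
  - rewrite mevalD mpolyCD; set x := _%:MP in Jp *; set y := _%:MP in Jq *.
    have -> : p + q - (x + y) = p - x + (q - y) by ring.
    exact: JD.
  - rewrite mevalM mpolyCM; set x := _%:MP in Jp *; set y := _%:MP in Jq *.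
    have -> : p * q - x * y = q * (p - x) + x * (q - y) by ring.
    by apply: (JD); exact: JM.
have [p Ip pa] := noz a; apply: nJ1.
have /(JM (p.@[a]^-1)%:MP) : J p.@[a]%:MP.
  have -> : p.@[a]%:MP = p + (- 1) * (p - p.@[a]%:MP) by ring.
  by apply: (JD); [exact: IJ|exact: JM].
by rewrite -mpolyCM mulVf// mpolyC1.
Qed.

End Nullstellensatz.

Lemma realType_uncountable (R : realType) : ~ countable [set: R].
Proof.
move=> cR; have cI : countable `[0 : R, 1].
  exact: sub_countable (subset_card_le (@subsetT _ _)) cR.
have := lebesgue_measure.countable_lebesgue_measure0 cI.
rewrite lebesgue_measure.lebesgue_measure_itv/=.
rewrite constructive_ereal.lte_fin ltr01 -constructive_ereal.EFinB subr0.
by move=> [] /eqP; rewrite oner_eq0.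
Qed.

(** A countable union of finite sets of real numbers is not R, so one of the
    sets of reals where D is bounded is infinite. *)
Lemma complex_uncountable (R : realType) : has_uncountable_fibres R[i].
Proof.
move=> D; pose A m := [set r : R | (D r%:C%C <= m)%N].
have [m infA] : exists m, infinite_set (A m).
  apply/existsNP => finA; apply: (@realType_uncountable R).
  have -> : [set: R] = \bigcup_m A m.
    by rewrite eqEsubset; split=> // r _; exists (D r%:C%C); rewrite /A/=.
  by apply: bigcup_countable => // m _; exact/finite_set_countable/finA.
have /infiniteP/card_leP[f] := infA.
pose g (j : nat) : R := val (f (SigSub (in_setT j))).
have ginj : injective g.
  by move=> i j /val_inj/(@inj _ _ _ f)-/(_ (in_setT _) (in_setT _))[].
have gA j : A m (g j) by exact/set_mem/valP.
exists m => N; exists (fun j : 'I_N => (g j)%:C%C); split=> [i j [/ginj ij]|j].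
  exact: val_inj.
exact: gA.
Qed.

(** * Polynomials in one variable *)

Section OneVariable.
Variable k : closedFieldType.

(** A nonzero polynomial that vanished everywhere would make p + 1 a nonconstant
    polynomial without roots. *)
Lemma horner_eq0_poly0 (p : {poly k}) : (forall z, p.[z] = 0) -> p = 0.
Proof.
move=> p0; have /eqP sp : size (p + 1) == 1%N.
  apply: contraT => /closed_rootP[z]; rewrite /root hornerD p0 add0r hornerC.
  by rewrite oner_eq0.
have pC : p = (p`_0)%:P.
  apply: size1_polyC; rewrite -(addrK 1 p) (leq_trans (size_polyD _ _))//.
  by rewrite geq_max size_polyN size_poly1 sp.
by have := p0 0; rewrite {1}pC hornerC => c0; rewrite pC c0 polyC0.
Qed.

Lemma horner_eq0_poly0_punctured (p : {poly k}) :
  (forall z, z != 0 -> p.[z] = 0) -> p = 0.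
Proof.
move=> p0; have /eqP : p * 'X = 0.
  apply: horner_eq0_poly0 => z; rewrite hornerM hornerX.
  by have [->|/p0->] := eqVneq z 0; rewrite ?mulr0 ?mul0r.
by rewrite mulf_eq0 polyX_eq0 orbF => /eqP.
Qed.

(** The derivatives of the polynomials that vanish at 0 and -1, that is, the
    polynomials with integral 0 over the segment from -1 to 0. *)
Definition exact_on_segment (q : {poly k}) :=
  exists r : {poly k}, q = ('X * (1 + 'X) * r)^`().

Lemma exact_on_segment0 : exact_on_segment 0.
Proof. by exists 0; rewrite mulr0 deriv0. Qed.

Lemma exact_on_segmentD (q r : {poly k}) :
  exact_on_segment q -> exact_on_segment r -> exact_on_segment (q + r).
Proof.
by move=> [q' ->] [r' ->]; exists (q' + r'); rewrite -derivD -mulrDr.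
Qed.

Lemma exact_on_segmentZ c (q : {poly k}) :
  exact_on_segment q -> exact_on_segment (c *: q).
Proof. by move=> [q' ->]; exists (c *: q'); rewrite -scalerAr derivZ. Qed.

Lemma exact_on_segment_const c : [pchar k] =i pred0 ->
  exact_on_segment c%:P -> c = 0.
Proof.
move=> ch0 [r E]; pose s := 'X * (1 + 'X) * r - c *: 'X.
have s' : s^`() = 0 by rewrite derivB -E derivZ derivX alg_polyC subrr.
have sC : s = (s`_0)%:P.
  apply/polyP => -[|i]; rewrite coefC//=.
  have /(congr1 (fun t : {poly k} => t`_i)) := s'; rewrite coef_deriv coef0.
  by move/eqP; rewrite -mulr_natr mulf_eq0 ((pcharf0P k).1 ch0) orbF => /eqP.
have s0 : s.[0] = 0 by rewrite /s !hornerE; ring.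
have s1 : s.[-1] = c by rewrite /s !hornerE; ring.
by rewrite -s1 -s0 sC !hornerC.
Qed.

End OneVariable.

(** * The torus average of a polynomial function on SL_2 *)

Section TorusAverage.
Variable k : closedFieldType.

(** The average of x^a y^b u^c v^e over the matrices of SL_2 with entries
    x = l, y = m z, u = m^-1, v = l^-1 (1 + z), where l and m run over the
    torus: only the weight-zero monomials (x v)^a (y u)^b survive. *)
Definition torus_monomial (m : 'X_{1..4}) : {poly k} :=
  if (m (inord 0) == m (inord 3)) && (m (inord 1) == m (inord 2))
  then (1 + 'X) ^+ m (inord 0) * 'X ^+ m (inord 1) else 0.

Definition torus_average (p : {mpoly k[4]}) : {poly k} :=
  \sum_(m <- msupp p) p@_m *: torus_monomial m.

Lemma torus_averageE p b : (msize p <= b)%N ->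
  torus_average p = \sum_(m : 'X_{1..4 < b}) p@_m *: torus_monomial m.
Proof.
move=> pb; rewrite /torus_average (big_mksub 'X_{1..4 < b})/=; first last.
- by move=> m /msize_mdeg_lt /leq_trans; apply.
- exact: msupp_uniq.
by rewrite big_rmcond //= => m /memN_msupp_eq0->; rewrite scale0r.
Qed.

Lemma torus_averageD p q :
  torus_average (p + q) = torus_average p + torus_average q.
Proof.
pose b := maxn (msize (p + q)) (maxn (msize p) (msize q)).
rewrite !(@torus_averageE _ b) ?leq_max ?leqnn ?orbT//.
by rewrite -big_split; apply: eq_bigr => m _; rewrite mcoeffD scalerDl.
Qed.

Lemma torus_averageZ c p : torus_average (c *: p) = c *: torus_average p.
Proof.
pose b := maxn (msize (c *: p)) (msize p).
rewrite !(@torus_averageE _ b) ?leq_max ?leqnn ?orbT//.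
by rewrite scaler_sumr; apply: eq_bigr => m _; rewrite mcoeffZ scalerA.
Qed.

Lemma torus_averageX m : torus_average 'X_[m] = torus_monomial m.
Proof. by rewrite /torus_average msuppX big_seq1 mcoeffX eqxx scale1r. Qed.

Lemma torus_averageC c : torus_average c%:MP = c%:P.
Proof.
have -> : c%:MP = c *: 'X_[0] :> {mpoly k[4]}.
  by rewrite -mul_mpolyC mpolyX0 mulr1.
rewrite torus_averageZ torus_averageX /torus_monomial !mnm0E !eqxx !expr0 mulr1.
by rewrite alg_polyC.
Qed.

Lemma inord4_eqE a b : (a < 4)%N -> (b < 4)%N ->
  ((inord a : 'I_4) == inord b) = (a == b).
Proof. by move=> ? ?; rewrite -val_eqE/= !inordK. Qed.

Lemma sum_ord4 (V : nmodType) (F : 'I_4 -> V) :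
  \sum_i F i = F (inord 0) + F (inord 1) + F (inord 2) + F (inord 3).
Proof.
rewrite !big_ord_recl big_ord0 addr0 !addrA.
by congr (_ + _ + _ + _); congr F; apply/val_inj; rewrite /= inordK.
Qed.

Lemma prod_ord4 (F : 'I_4 -> k) :
  \prod_i F i = F (inord 0) * F (inord 1) * F (inord 2) * F (inord 3).
Proof.
rewrite !big_ord_recl big_ord0 mulr1 !mulrA.
by congr (_ * _ * _ * _); congr F; apply/val_inj; rewrite /= inordK.
Qed.

Definition quad (S : Type) (x y u v : S) (i : 'I_4) : S :=
  nth x [:: x; y; u; v] i.

Lemma quadE (S : Type) (x y u v : S) :
  ((quad x y u v (inord 0) = x) * (quad x y u v (inord 1) = y) *
   (quad x y u v (inord 2) = u) * (quad x y u v (inord 3) = v))%type.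
Proof. by rewrite /quad !inordK. Qed.

(** The average is read off from the values of p: on the curve l = s, m = s^K
    through SL_2, with K larger than twice the degree of p, the exponent of s
    determines the weights of a monomial with respect to l and m, and the
    average is the coefficient of s^0. *)
Lemma torus_average_eq0 p :
  (forall x y u v, x * v - y * u = 1 -> p.@[quad x y u v] = 0) ->
  torus_average p = 0.
Proof.
move=> p0; apply: horner_eq0_poly0 => z.
pose N := msize p; have [K KE] : exists K, K = (2 * N).+1 by exists (2 * N).+1.
(* The exponent of s, shifted by N + K * N so as to be a natural number. *)
pose ex (m : 'X_{1..4}) := (N + m (inord 0) - m (inord 3) +
  K * (N + m (inord 1) - m (inord 2)))%N.
have mN (m : 'X_{1..4 < N}) i : (m i < N)%N.
  apply: leq_ltn_trans (bmdeg m); rewrite mdegE (bigD1 i)//=; exact: leq_addr.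
pose H := \sum_(m : 'X_{1..4 < N})
  (p@_m * ((1 + z) ^+ m (inord 3) * z ^+ m (inord 1))) *: 'X^(ex m) : {poly k}.
have H0 : H = 0.
  apply: horner_eq0_poly0_punctured => s s0.
  have muK : s ^+ K != 0 by rewrite expf_neq0.
  have E : (s * (s^-1 * (1 + z)) - (s ^+ K * z) * (s ^+ K)^-1 = 1).
    by move: (s ^+ K) muK => mu mu0; field; rewrite s0 mu0.
  have /(congr1 (fun t => s ^+ (N + K * N) * t)) := p0 _ _ _ _ E.
  rewrite mulr0 => <-; rewrite {1}[p](mpolywE (leqnn _)) horner_sum raddf_sum.
  rewrite big_distrr/=; apply: eq_bigr => m _.
  rewrite hornerZ hornerXn mevalZ mevalX prod_ord4 !quadE.
  have ltm := mN m; set p_m := p@_m; rewrite /ex.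
  have := ltm (inord 0); have := ltm (inord 1).
  have := ltm (inord 2); have := ltm (inord 3).
  move: (m (inord 0)) (m (inord 1)) (m (inord 2)) (m (inord 3)) => a b c e.
  move=> eN cN bN aN.
  have E1 : s ^+ (N + a - e) = s ^+ (N + a) * (s ^+ e)^-1.
    by rewrite -[in RHS](@subnK e (N + a)) ?exprD ?mulfK ?expf_neq0//; lia.
  have E2 : s ^+ (K * (N + b - c)) = s ^+ (K * (N + b)) * (s ^+ (K * c))^-1.
    rewrite -[in RHS](@subnK c (N + b)); last by lia.
    by rewrite mulnDr [in RHS]exprD mulfK ?expf_neq0.
  rewrite exprD E1 E2 !exprMn !exprVn -!exprM !mulnDr !exprD.
  have := expf_neq0 e s0; have := expf_neq0 (K * c) s0.
  move: (s ^+ e) (s ^+ (K * c)) (s ^+ N) (s ^+ (K * N)) (s ^+ a) (s ^+ (K * b)).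
  move: (z ^+ b) ((1 + z) ^+ e) p_m => zb ze q s1 s2 s3 s4 s5 s6 s1n0 s2n0.
  by field; rewrite s1n0 s2n0.
have : H`_(N + K * N)%N = 0 by rewrite H0 coef0.
rewrite coef_sum => E; rewrite -[RHS]E.
rewrite (@torus_averageE _ N)// horner_sum; apply: eq_bigr => m _.
rewrite hornerZ coefZ coefXn -mulrA; congr (_ * _).
have ltm := mN m; rewrite /torus_monomial /ex.
have := ltm (inord 0); have := ltm (inord 1).
have := ltm (inord 2); have := ltm (inord 3).
move: (m (inord 0)) (m (inord 1)) (m (inord 2)) (m (inord 3)) => a b c e.
move=> eN cN bN aN.
have -> : ((N + K * N)%N == (N + a - e + K * (N + b - c))%N) =
   (a == e) && (b == c).
  apply/eqP/andP => [Eq|[/eqP-> /eqP->]]; last by rewrite !addnK.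
  have lt1 : (N + a - e < K)%N by rewrite KE; lia.
  have lt2 : (N < K)%N by rewrite KE; lia.
  have K0 : (0 < K)%N by rewrite KE.
  have /(congr1 (divn^~ K)) := Eq.
  rewrite ![(_ + K * _)%N]addnC ![(K * _)%N]mulnC !divnMDl// !divn_small//.
  rewrite !addn0.
  move=> EB; move: Eq; rewrite -EB => /addIn EA.
  by split; apply/eqP; lia.
case: ifP => [/andP[/eqP-> /eqP->]|_]; last by rewrite horner0 mulr0.
by rewrite mulr1 hornerM !horner_exp hornerD hornerC hornerX.
Qed.

End TorusAverage.

(** * The invariant vector fields of SL_2 *)

Section SL2Fields.
Variable k : closedFieldType.
Implicit Types p q : {mpoly k[4]}.

Let X (j : nat) : {mpoly k[4]} := 'X_(inord j).

(** The vector fields of left multiplication by E_21, E_12 and E_11 - E_22 on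
    matrices with rows (x, y) and (u, v). *)
Definition sl2_e : 'I_4 -> {mpoly k[4]} := quad 0 0 (X 0) (X 1).
Definition sl2_f : 'I_4 -> {mpoly k[4]} := quad (X 2) (X 3) 0 0.
Definition sl2_h : 'I_4 -> {mpoly k[4]} := quad (X 0) (X 1) (- X 2) (- X 3).

Lemma ord4P (P : 'I_4 -> Prop) :
  P (inord 0) -> P (inord 1) -> P (inord 2) -> P (inord 3) -> forall i, P i.
Proof.
move=> P0 P1 P2 P3 i; have := ltn_ord i; rewrite -{2}(inord_val i).
by case: (nat_of_ord i) => [|[|[|[|]]]].
Qed.

Lemma sl2_commutator_ef p :
  field_deriv sl2_e (field_deriv sl2_f p) -
  field_deriv sl2_f (field_deriv sl2_e p) = field_deriv sl2_h p.
Proof.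
rewrite field_deriv_commutator; apply: eq_field_deriv; apply: ord4P;
by rewrite /sl2_e/sl2_f/sl2_h !quadE ?field_deriv0 /X !field_derivX !quadE
   ?subr0 ?sub0r.
Qed.

Lemma sl2_commutator_he p :
  field_deriv sl2_h (field_deriv sl2_e p) -
  field_deriv sl2_e (field_deriv sl2_h p) = 2%:R *: field_deriv sl2_e p.
Proof.
rewrite field_deriv_commutator -field_deriv_scale.
apply: eq_field_deriv; apply: ord4P;
by rewrite /sl2_e/sl2_f/sl2_h !quadE ?field_deriv0 /X ?field_derivN
   !field_derivX !quadE ?subr0 ?opprK ?scaler0// scaler_nat mulr2n.
Qed.

Lemma sl2_commutator_hf p :
  field_deriv sl2_h (field_deriv sl2_f p) -
  field_deriv sl2_f (field_deriv sl2_h p) = (- 2%:R) *: field_deriv sl2_f p.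
Proof.
rewrite field_deriv_commutator -field_deriv_scale.
apply: eq_field_deriv; apply: ord4P;
by rewrite /sl2_e/sl2_f/sl2_h !quadE ?field_deriv0 /X ?field_derivN
   !field_derivX !quadE ?oppr0 ?subr0 ?scaler0 ?addr0// scaleNr scaler_nat
   mulr2n opprD.
Qed.

Lemma additive_monomial_ind (C : {mpoly k[4]} -> Prop) :
  C 0 -> (forall p q, C p -> C q -> C (p + q)) ->
  (forall c p, C p -> C (c *: p)) -> (forall m, C 'X_[m]) -> forall p, C p.
Proof.
move=> C0 CD CZ CX; elim/mpolyind => // c m p _ _ Cp.
by apply: CD => //; apply: CZ.
Qed.

Lemma torus_average_field (v : 'I_4 -> {mpoly k[4]}) :
  (forall m, exact_on_segment (torus_average (field_deriv v 'X_[m]))) ->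
  forall p, exact_on_segment (torus_average (field_deriv v p)).
Proof.
move=> vX; apply: additive_monomial_ind => //.
- rewrite field_deriv0 -(mpolyC0 4 k) torus_averageC.
  exact: exact_on_segment0.
- by move=> p q; rewrite field_derivD torus_averageD; exact: exact_on_segmentD.
- move=> c p; rewrite field_derivZ torus_averageZ.
  exact: exact_on_segmentZ.
Qed.

Lemma torus_averageXderiv i j m :
  torus_average ('X_i * 'X_[m]^`M(j)) =
  (m j)%:R *: torus_monomial k (U_(i) + (m - U_(j))).
Proof.
by rewrite mderivX -scalerAr torus_averageZ -mpolyXD torus_averageX.
Qed.

(** The terms of a derivative have natural coefficients that vanish where their
    exponents, truncated differences, would be negative; the conditions B and C
    on exponents need only agree elsewhere. *)
Lemma natr_scale_if n (B C : bool) (t t' : {poly k}) :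
  ((0 < n)%N -> B = C) -> ((0 < n)%N -> C -> t = t') ->
  n%:R *: (if B then t else 0) = if C then n%:R *: t' else 0.
Proof.
case: n => [|n] BC tt; first by rewrite !scale0r if_same.
by rewrite BC//; case: (C) tt => [->|]; rewrite ?scaler0.
Qed.

(** The integral of e p is zero.  For a monomial p the two terms of e p have
    weight zero together, and they are then the two terms of the derivative of
    (1 + z)^(a+1) z^(b+1). *)
Lemma torus_average_e p :
  exact_on_segment (torus_average (field_deriv sl2_e p)).
Proof.
apply: torus_average_field => m.
rewrite /field_deriv sum_ord4 /sl2_e !quadE !mul0r !add0r torus_averageD.
rewrite !torus_averageXderiv /torus_monomial !mnmDE !mnmBE !mnm1E.
rewrite !inord4_eqE//= !subn0 !add0n add1n.
move: (m (inord 0)) (m (inord 1)) (m (inord 2)) (m (inord 3)) => a b c e.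
pose C := (c == b.+1) && (e == a.+1).
rewrite (@natr_scale_if c _ C _ ((1 + 'X) ^+ a.+1 * 'X ^+ b))//; last by lia.
rewrite (@natr_scale_if e _ C _ ((1 + 'X) ^+ a * 'X ^+ b.+1))//; last by lia.
rewrite /C; case: andP => [[/eqP-> /eqP->]|_]; last first.
  by rewrite addr0; exact: exact_on_segment0.
exists ((1 + 'X) ^+ a * 'X ^+ b).
have -> : 'X * (1 + 'X) * ((1 + 'X) ^+ a * 'X ^+ b) =
          (1 + 'X) ^+ a.+1 * 'X ^+ b.+1 :> {poly k} by rewrite !exprS; ring.
rewrite derivM !deriv_exp/= derivD derivC derivX add0r !scaler_nat.
by rewrite !mul1r !mulrnAl !mulrnAr addrC.
Qed.

Lemma torus_average_f p :
  exact_on_segment (torus_average (field_deriv sl2_f p)).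
Proof.
apply: torus_average_field => m.
rewrite /field_deriv sum_ord4 /sl2_f !quadE !mul0r !addr0 torus_averageD.
rewrite !torus_averageXderiv /torus_monomial !mnmDE !mnmBE !mnm1E.
rewrite !inord4_eqE//= !subn0 !add0n add1n.
move: (m (inord 0)) (m (inord 1)) (m (inord 2)) (m (inord 3)) => a b c e.
pose C := (b == c.+1) && (a == e.+1).
rewrite (@natr_scale_if a _ C _ ((1 + 'X) ^+ e * 'X ^+ c.+1)); first last.
- by move=> _ /andP[/eqP-> /eqP->]; rewrite subn1.
- by rewrite /C; lia.
rewrite (@natr_scale_if b _ C _ ((1 + 'X) ^+ e.+1 * 'X ^+ c)); first last.
- by move=> _ /andP[/eqP-> /eqP->]; rewrite subn1.
- by rewrite /C; lia.
rewrite /C; case: andP => [[/eqP-> /eqP->]|_]; last first.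
  by rewrite addr0; exact: exact_on_segment0.
exists ((1 + 'X) ^+ e * 'X ^+ c).
have -> : 'X * (1 + 'X) * ((1 + 'X) ^+ e * 'X ^+ c) =
          (1 + 'X) ^+ e.+1 * 'X ^+ c.+1 :> {poly k} by rewrite !exprS; ring.
rewrite derivM !deriv_exp/= derivD derivC derivX add0r !scaler_nat.
by rewrite !mul1r !mulrnAl !mulrnAr.
Qed.

(** Here h multiplies a monomial by a + b - c - e, which is zero in weight
    zero. *)
Lemma torus_average_h p :
  exact_on_segment (torus_average (field_deriv sl2_h p)).
Proof.
apply: torus_average_field => m.
rewrite /field_deriv sum_ord4 /sl2_h !quadE !mulNr -!scaleN1r !torus_averageD.
rewrite !torus_averageZ !torus_averageXderiv /torus_monomial.
rewrite !mnmDE !mnmBE !mnm1E !inord4_eqE//= !subn0 !add0n.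
move: (m (inord 0)) (m (inord 1)) (m (inord 2)) (m (inord 3)) => a b c e.
pose C := (a == e) && (b == c); pose t : {poly k} := (1 + 'X) ^+ a * 'X ^+ b.
rewrite (@natr_scale_if a _ C _ t); first last.
- by move=> a0; rewrite /t subnKC.
- by rewrite /C; lia.
rewrite (@natr_scale_if b _ C _ t); first last.
- by move=> b0; rewrite /t subnKC.
- by rewrite /C; lia.
rewrite (@natr_scale_if c _ C _ t)//; last by rewrite /C; lia.
rewrite (@natr_scale_if e _ C _ t)//; last by rewrite /C; lia.
rewrite /C; case: andP => [[/eqP-> /eqP->]|_].
  have -> : e%:R *: t + c%:R *: t + -1 *: (c%:R *: t) + -1 *: (e%:R *: t) = 0.
    by rewrite !scaleN1r addrK subrr.
  exact: exact_on_segment0.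
by rewrite !scaler0 !addr0; exact: exact_on_segment0.
Qed.
End SL2Fields.

(** * Differential calculus of regular functions *)

(* Stated for an abstract space, so that neighbourhoods in affine_sub A are not
   unfolded when these facts are applied there. *)
Section AbstractNeighbourhoods.
Variables (T : topologicalType) (x : T).

Lemma nbhs_setI (P Q : set T) : nbhs x P -> nbhs x Q -> nbhs x (P `&` Q).
Proof. exact: filterI. Qed.

Lemma nbhs_mono (P Q : set T) : nbhs x P -> (forall y, P y -> Q y) -> nbhs x Q.
Proof. by move=> xP PQ; apply: filterS xP. Qed.

Lemma nbhs_all (P : set T) : (forall y, P y) -> nbhs x P.
Proof. exact: nearW. Qed.

Lemma nbhs_nbhs (P : set T) : nbhs x P -> nbhs x (fun y => nbhs y P).
Proof. by move/nbhs_interior. Qed.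

Lemma nbhs_at (P : set T) : nbhs x P -> P x.
Proof. exact: nbhs_singleton. Qed.

End AbstractNeighbourhoods.

Section LocalCalculus.
Variables (k : closedFieldType) (n : nat) (A : set 'rV[k]_n).
Implicit Types (f g h : affine_sub A -> k) (p q : {mpoly k[n]}).
Implicit Types (x y : affine_sub A).

Definition local_frac f p q x := nbhs x
  (fun y => peval q y != 0 /\ f y = peval p y / peval q y).

Definition regular_at f x := exists p q, local_frac f p q x.

Lemma nbhs_zariski x (P : set (affine_sub A)) :
  nbhs x P <-> exists r : {mpoly k[n]},
    peval r x != 0 /\ forall y, peval r y != 0 -> P y.
Proof.
split.
  rewrite nbhsE => -[U [oU Ux] UP].
  have [r [rx rU]] := oU x Ux.
  by exists r; split=> // y /rU/UP.
move=> [r [rx rP]]; rewrite nbhsE; exists [set y | peval r y != 0] => //.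
split; last exact: rx.
by rewrite openE_zariski => y ry; exists r.
Qed.

Lemma local_frac_near f p q x : local_frac f p q x ->
  nbhs x (fun y => local_frac f p q y).
Proof. exact: nbhs_nbhs. Qed.

Lemma local_frac_eq f g p q x : nbhs x (fun y => f y = g y) ->
  local_frac f p q x -> local_frac g p q x.
Proof.
rewrite /local_frac => fg fpq.
by apply: (nbhs_mono (nbhs_setI fg fpq)) => y [->].
Qed.

Lemma regular_at_eq f g x : nbhs x (fun y => f y = g y) ->
  regular_at f x -> regular_at g x.
Proof. by move=> fg [p [q fpq]]; exists p, q; exact: local_frac_eq fpq. Qed.

Lemma regular_at_near f x : regular_at f x -> nbhs x (regular_at f).
Proof.
move=> [p [q /local_frac_near fpq]].
by apply: (nbhs_mono fpq) => y ?; exists p, q.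
Qed.

Lemma local_frac_poly p x : local_frac (peval p) p 1 x.
Proof.
rewrite /local_frac; apply: nbhs_all => y.
by rewrite /peval meval1 divr1 oner_neq0.
Qed.

Lemma local_fracD f g p q r s x : local_frac f p q x -> local_frac g r s x ->
  local_frac (fun y => f y + g y) (p * s + r * q) (q * s) x.
Proof.
rewrite /local_frac => fpq grs.
apply: (nbhs_mono (nbhs_setI fpq grs)) => y [[q0 ->] [s0 ->]].
by rewrite /peval mevalD !mevalM addf_div ?mulf_neq0.
Qed.

Lemma local_fracM f g p q r s x : local_frac f p q x -> local_frac g r s x ->
  local_frac (fun y => f y * g y) (p * r) (q * s) x.
Proof.
rewrite /local_frac => fpq grs.
apply: (nbhs_mono (nbhs_setI fpq grs)) => y [[q0 ->] [s0 ->]].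
by rewrite /peval !mevalM mulf_div mulf_neq0.
Qed.

Lemma regular_at_poly p x : regular_at (peval p) x.
Proof. by exists p, 1; exact: local_frac_poly. Qed.

Lemma regular_at_cst c x : regular_at (fun=> c) x.
Proof.
apply: regular_at_eq (regular_at_poly c%:MP x).
by apply: nbhs_all => y; rewrite /peval mevalC.
Qed.

Lemma regular_atD f g x : regular_at f x -> regular_at g x ->
  regular_at (fun y => f y + g y) x.
Proof.
by move=> [p [q ?]] [r [s ?]]; do 2 eexists; apply: local_fracD; eassumption.
Qed.

Lemma regular_atM f g x : regular_at f x -> regular_at g x ->
  regular_at (fun y => f y * g y) x.
Proof.
by move=> [p [q ?]] [r [s ?]]; do 2 eexists; apply: local_fracM; eassumption.
Qed.

Lemma regular_atB f g x : regular_at f x -> regular_at g x ->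
  regular_at (fun y => f y - g y) x.
Proof.
move=> rf rg; have rN := regular_atM (regular_at_cst (-1) x) rg.
apply: regular_at_eq (regular_atD rf rN).
by apply: nbhs_all => y; rewrite mulN1r.
Qed.

(** The field v preserves the ideal of the polynomials that vanish on A. *)
Definition tangent (v : 'I_n -> {mpoly k[n]}) := forall p,
  (forall y : affine_sub A, peval p y = 0) ->
  forall y : affine_sub A, peval (field_deriv v p) y = 0.

Definition quotient_deriv v p q x :=
  (peval (field_deriv v p) x * peval q x -
   peval p x * peval (field_deriv v q) x) / peval q x ^+ 2.

(** The derivative of f along v at x, for f equal to p / q near x; it does not
    depend on p and q if v is tangent to A, see fun_derivE. *)
Definition fun_deriv v f x : k := xget 0
  [set c | exists p q, local_frac f p q x /\ c = quotient_deriv v p q x].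

Lemma fun_deriv_eq v f g x : nbhs x (fun y => f y = g y) ->
  fun_deriv v f x = fun_deriv v g x.
Proof.
move=> fg; have gf : nbhs x (fun y => g y = f y).
  by apply: (nbhs_mono fg) => y ->.
congr xget; rewrite eqEsubset.
split=> c [p [q [fpq ->]]]; exists p, q; split=> //.
- exact: local_frac_eq fpq.
- exact: local_frac_eq fpq.
Qed.

Section Tangent.
Variable v : 'I_n -> {mpoly k[n]}.
Hypothesis tv : tangent v.
Let D := field_deriv v.

(** If p / q = r / s where t is nonzero, then t (p s - r q) vanishes on all of
    A, hence so does its derivative; at a point where t is nonzero, this says
    that the quotient rule gives the same value for p / q and r / s. *)
Lemma fun_derivE f p q x : local_frac f p q x ->
  fun_deriv v f x = quotient_deriv v p q x.
Proof.
move=> fpq; rewrite /fun_deriv; case: xgetP; last first.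
  by move=> /(_ (quotient_deriv v p q x))[]; exists p, q.
move=> c _ [r [s [frs ->]]].
have [t [tx tP]] := (nbhs_zariski _ _).1 (nbhs_setI fpq frs).
have [[qx _] [sx _]] := tP x tx.
have z y : peval (t * (p * s - r * q)) y = 0.
  rewrite /peval mevalM mevalB !mevalM -!/(peval _ y).
  have [->|/tP[[q0 fE] [s0]]] := eqVneq (peval t y) 0; first by rewrite mul0r.
  rewrite fE => E; suff -> : peval p y * peval s y = peval r y * peval q y.
    by rewrite subrr mulr0.
  by move/eqP: E; rewrite eqr_div// => /eqP->.
have := tv z x; rewrite field_derivM field_derivB !field_derivM.
have := tP x tx => -[[_ fE] [_]]; rewrite fE.
rewrite /quotient_deriv /peval !(mevalD, mevalN, mevalM) -!/(peval _ x).
move=> E Z.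
set p0 := peval p x in E Z *; set q0 := peval q x in qx E Z *.
set r0 := peval r x in E Z *; set s0 := peval s x in sx E Z *.
have E' : p0 * s0 = r0 * q0 by apply/eqP; rewrite -eqr_div// E.
move: Z; rewrite E' subrr mulr0 add0r => /eqP; rewrite mulf_eq0 (negPf tx)/=.
move=> /eqP Z; apply/eqP; rewrite eqr_div ?expf_neq0//; apply/eqP.
have rE : r0 = p0 * s0 / q0 by rewrite E' mulfK.
move: Z; rewrite !rE => Z.
set a := peval (field_deriv v r) x in Z *.
set b := peval (field_deriv v q) x in Z *.
set c' := peval (field_deriv v p) x in Z *.
set d := peval (field_deriv v s) x in Z *.
have aE : a = (c' * s0 + p0 * d - p0 * s0 / q0 * b) / q0.
  apply: (mulIf qx); rewrite mulfVK//; apply/eqP; rewrite -subr_eq0 -oppr_eq0.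
  by apply/eqP; rewrite -[RHS]Z; ring.
by rewrite aE; field.
Qed.

Lemma fun_deriv_poly p x : fun_deriv v (peval p) x = peval (D p) x.
Proof.
rewrite (fun_derivE (local_frac_poly p x)) /quotient_deriv.
have -> : field_deriv v 1 = 0 by rewrite -(mpolyC1 n k) field_derivC.
rewrite /peval meval1 meval0.
by rewrite mulr0 subr0 mulr1 expr1n divr1.
Qed.

Lemma fun_deriv_cst c x : fun_deriv v (fun=> c) x = 0.
Proof.
rewrite (@fun_deriv_eq _ _ (peval c%:MP)).
  by rewrite fun_deriv_poly /D field_derivC /peval raddf0.
by apply: nbhs_all => y; rewrite /peval mevalC.
Qed.

Lemma fun_derivD f g x : regular_at f x -> regular_at g x ->
  fun_deriv v (fun y => f y + g y) x = fun_deriv v f x + fun_deriv v g x.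
Proof.
move=> [p [q fpq]] [r [s grs]]; rewrite (fun_derivE (local_fracD fpq grs)).
rewrite (fun_derivE fpq) (fun_derivE grs).
have [q0 _] := nbhs_at fpq; have [s0 _] := nbhs_at grs.
rewrite /quotient_deriv field_derivD !field_derivM /peval.
rewrite !(mevalD, mevalM) -!/(peval _ x).
by field; rewrite q0 s0.
Qed.

Lemma fun_derivM f g x : regular_at f x -> regular_at g x ->
  fun_deriv v (fun y => f y * g y) x =
  fun_deriv v f x * g x + f x * fun_deriv v g x.
Proof.
move=> [p [q fpq]] [r [s grs]]; rewrite (fun_derivE (local_fracM fpq grs)).
rewrite (fun_derivE fpq) (fun_derivE grs).
have [q0 ->] := nbhs_at fpq; have [s0 ->] := nbhs_at grs.
rewrite /quotient_deriv !field_derivM /peval.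
rewrite !(mevalD, mevalM) -!/(peval _ x).
by field; rewrite q0 s0.
Qed.

Lemma fun_derivB f g x : regular_at f x -> regular_at g x ->
  fun_deriv v (fun y => f y - g y) x = fun_deriv v f x - fun_deriv v g x.
Proof.
move=> rf rg; have rN := regular_atM (regular_at_cst (-1) x) rg.
rewrite (@fun_deriv_eq _ _ (fun y => f y + -1 * g y)).
  rewrite fun_derivD// fun_derivM// ?fun_deriv_cst; last exact: regular_at_cst.
  by ring.
by apply: nbhs_all => y; rewrite mulN1r.
Qed.

Lemma local_frac_deriv f p q x : local_frac f p q x ->
  local_frac (fun_deriv v f) (D p * q - p * D q) (q ^+ 2) x.
Proof.
move=> /local_frac_near fpq; rewrite /local_frac.
apply: (nbhs_mono fpq) => y fpqy.
have [q0 _] := nbhs_at fpqy.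
rewrite (fun_derivE fpqy) /quotient_deriv /peval.
by rewrite !expr2 mevalB !mevalM mulf_neq0.
Qed.

Lemma regular_at_deriv f x : regular_at f x -> regular_at (fun_deriv v f) x.
Proof. by move=> [p [q /local_frac_deriv ?]]; do 2 eexists; eassumption. Qed.

Lemma regular_at_comp m (F : 'I_m -> affine_sub A -> k) (P : {mpoly k[m]}) x :
  (forall i, regular_at (F i) x) -> regular_at (fun y => P.@[F^~ y]) x.
Proof.
move=> rF; elim/mpoly_subring_ind: P => [c|i|P Q IP IQ|P Q IP IQ].
- apply: regular_at_eq (regular_at_cst c x).
  by apply: nbhs_all => y; rewrite mevalC.
- apply: regular_at_eq (rF i).
  by apply: nbhs_all => y; rewrite mevalXU.
- apply: regular_at_eq (regular_atD IP IQ).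
  by apply: nbhs_all => y; rewrite mevalD.
- apply: regular_at_eq (regular_atM IP IQ).
  by apply: nbhs_all => y; rewrite mevalM.
Qed.

Lemma fun_deriv_comp m (F : 'I_m -> affine_sub A -> k) (P : {mpoly k[m]}) x :
  (forall i, regular_at (F i) x) ->
  fun_deriv v (fun y => P.@[F^~ y]) x =
  \sum_i fun_deriv v (F i) x * (P^`M(i)).@[F^~ x].
Proof.
move=> rF; pose delta (Q : {mpoly k[m]}) := fun_deriv v (fun y => Q.@[F^~ y]) x.
rewrite -/(delta P) (@derivation_mpolyE _ _ _ (meval (F^~ x)) delta).
- apply: eq_bigr => i _; congr (_ * _); apply: fun_deriv_eq.
  by apply: nbhs_all => y; rewrite mevalXU.
- exact: mevalD.
- exact: mevalM.
- move=> Q S; rewrite /delta -fun_derivD; [|exact: regular_at_comp..].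
  by apply: fun_deriv_eq; apply: nbhs_all => y; rewrite mevalD.
- move=> c; rewrite /delta -(fun_deriv_cst c x); apply: fun_deriv_eq.
  by apply: nbhs_all => y; rewrite mevalC.
- move=> Q S; rewrite /delta.
  rewrite -(@fun_derivM (fun y => Q.@[F^~ y]) (fun y => S.@[F^~ y]));
    [|exact: regular_at_comp..].
  by apply: fun_deriv_eq; apply: nbhs_all => y; rewrite mevalM.
Qed.

Definition frac_partial m (P Q : {mpoly k[m]}) (a : 'I_m -> k) (i : 'I_m) : k :=
  ((P^`M(i)).@[a] * Q.@[a] - P.@[a] * (Q^`M(i)).@[a]) / Q.@[a] ^+ 2.

(** Chain rule.  The coefficients do not depend on the field v: they express the
    differential of h through those of the functions F_i. *)
Lemma fun_deriv_comp_frac m (F : 'I_m -> affine_sub A -> k)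
    (P Q : {mpoly k[m]}) h x :
  (forall i, regular_at (F i) x) -> regular_at h x ->
  nbhs x (fun y => Q.@[F^~ y] != 0 /\ h y = P.@[F^~ y] / Q.@[F^~ y]) ->
  fun_deriv v h x =
  \sum_i fun_deriv v (F i) x * frac_partial P Q (F^~ x) i.
Proof.
move=> rF rh hE; have [Q0 hx] := nbhs_at hE.
have E : fun_deriv v (fun y => h y * Q.@[F^~ y]) x =
    fun_deriv v (fun y => P.@[F^~ y]) x.
  by apply: fun_deriv_eq; apply: (nbhs_mono hE) => y [Qy ->]; rewrite mulfVK.
move: E; rewrite fun_derivM//; last exact: regular_at_comp.
rewrite !fun_deriv_comp// hx => E.
apply: (mulIf Q0); rewrite big_distrl/=.
move/(canRL (addrK _)): E => ->; rewrite big_distrr -sumrB.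
apply: eq_bigr => i _ /=.
by rewrite /frac_partial; field.
Qed.

End Tangent.

Lemma fun_deriv_commutator v w u c f x :
  tangent v -> tangent w -> tangent u ->
  (forall p, field_deriv v (field_deriv w p) - field_deriv w (field_deriv v p) =
             c *: field_deriv u p) ->
  regular_at f x ->
  fun_deriv v (fun_deriv w f) x - fun_deriv w (fun_deriv v f) x =
  c * fun_deriv u f x.
Proof.
move=> tv tw tu comm [p [q fpq]].
rewrite (fun_derivE tv (local_frac_deriv tw fpq)).
rewrite (fun_derivE tw (local_frac_deriv tv fpq)) (fun_derivE tu fpq).
have [q0 _] := nbhs_at fpq.
have commx r : peval (field_deriv v (field_deriv w r)) x =
    c * peval (field_deriv u r) x + peval (field_deriv w (field_deriv v r)) x.
  by rewrite /peval -mevalZ -comm mevalB subrK.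
rewrite /quotient_deriv !field_derivB !expr2 !field_derivM /peval.
rewrite !(mevalD, mevalN, mevalM) -!/(peval _ x) !commx.
by field.
Qed.

(** The polynomials q such that q f is a polynomial function form an ideal; it
    contains the equations I of A, and at each point of A a denominator of f. *)
Lemma regular_everywhere_poly (I : {mpoly k[n]} -> Prop) f :
  has_uncountable_fibres k ->
  (forall w, A w <-> forall p, I p -> p.@[fun i => w 0 i] = 0) ->
  (forall x, regular_at f x) -> exists p, forall x, f x = peval p x.
Proof.
move=> unc AE rf.
pose J (q : {mpoly k[n]}) := exists p, forall x, peval q x * f x = peval p x.
suff [p pP] : J 1 by exists p => x; rewrite -pP /peval meval1 mul1r.
apply: weak_Nullstellensatz unc _ _.
  split.
  - by exists 0 => x; rewrite /peval !raddf0 mul0r.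
  - move=> p q [p' pP] [q' qP]; exists (p' + q') => x.
    by rewrite /peval !mevalD mulrDl -!/(peval _ x) pP qP.
  - move=> p q [q' qP]; exists (p * q') => x.
    by rewrite /peval !mevalM -mulrA -!/(peval _ x) qP.
move=> a; have [Aa|nAa] := pselect (A (\row_i a i)).
  pose x : affine_sub A := SigSub (mem_set Aa).
  have xE r : peval r x = r.@[a] by apply: meval_eq => i; rewrite mxE.
  have [p [q fpq]] := rf x.
  have [r [rx rP]] := (nbhs_zariski _ _).1 fpq; have [qx _] := nbhs_at fpq.
  exists (r * q); last by rewrite mevalM mulf_neq0// -xE.
  exists (r * p) => y; rewrite /peval !mevalM -!/(peval _ y).
  have [->|/rP[q0 ->]] := eqVneq (peval r y) 0; first by rewrite !mul0r.
  by rewrite -mulrA; congr (_ * _); rewrite mulrC mulfVK.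
move: nAa; rewrite AE => /existsNP[p /not_implyP[Ip pa]].
exists p.
  exists 0 => x; rewrite /peval meval0 [X in X * _](_ : _ = 0) ?mul0r//.
  exact: (AE _).1 (set_mem (valP x)) _ Ip.
apply/eqP; rewrite (@meval_eq _ _ _ (fun i => (\row_i a i) 0 i))// => i.
by rewrite mxE.
Qed.

End LocalCalculus.

(** * Restriction to lines *)

Section Lines.
Variables (k : closedFieldType) (n : nat).
Implicit Types (p q : {mpoly k[n]}) (w d : 'I_n -> k).

Definition line_poly w d p : {poly k} :=
  mmap (@polyC k) (fun i => (w i)%:P + d i *: 'X) p.

Lemma horner_line_poly w d p s :
  (line_poly w d p).[s] = p.@[fun i => w i + d i * s].
Proof.
rewrite /line_poly; elim/mpoly_subring_ind: p => [c|i|p q IHp IHq|p q IHp IHq].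
- by rewrite mmapC hornerC mevalC.
- by rewrite mmapX mmap1U mevalXU !hornerE.
- by rewrite mmapD hornerD IHp IHq mevalD.
- by rewrite rmorphM/= hornerM IHp IHq mevalM.
Qed.

Lemma deriv_line_poly w d p :
  (line_poly w d p)^`().[0] = \sum_i d i * (p^`M(i)).@[w].
Proof.
have ev0 q : (line_poly w d q).[0] = q.@[w].
  by rewrite horner_line_poly; apply: meval_eq => i; rewrite mulr0 addr0.
rewrite (@derivation_mpolyE _ _ _ (meval w)
  (fun q => (line_poly w d q)^`().[0])).
- apply: eq_bigr => i _; rewrite /line_poly mmapX mmap1U.
  by rewrite derivD derivC derivZ derivX !hornerE.
- exact: mevalD.
- exact: mevalM.
- by move=> q r; rewrite /line_poly mmapD derivD hornerD.
- by move=> c; rewrite /line_poly mmapC derivC horner0.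
- by move=> q r; rewrite -!ev0 /line_poly rmorphM/= derivM hornerD !hornerM.
Qed.

Lemma tangent_lines (A : set 'rV[k]_n) (v : 'I_n -> {mpoly k[n]}) :
  (forall (w : 'rV_n) s, A w ->
    A (\row_i (w 0 i + (v i).@[fun j => w 0 j] * s))) ->
  tangent A v.
Proof.
move=> lineA p p0 y; pose w i := val y 0 i; pose d i := (v i).@[w].
have := deriv_line_poly w d p.
have -> : line_poly w d p = 0.
  apply: horner_eq0_poly0 => s; rewrite horner_line_poly.
  have Ay := lineA _ s (set_mem (valP y)).
  rewrite -[RHS](p0 (SigSub (mem_set Ay))); apply: meval_eq => i.
  by rewrite mxE.
rewrite deriv0 horner0 => E; rewrite /peval /field_deriv raddf_sum/= [RHS]E.
by apply: eq_bigr => i _; rewrite mevalM.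
Qed.

(** A nonconstant polynomial over an algebraically closed field has a root. *)
Lemma nonvanishing_line p w d :
  (forall s, p.@[fun i => w i + d i * s] != 0) ->
  forall s, p.@[fun i => w i + d i * s] = p.@[w].
Proof.
move=> p0 s; have ev0 : (line_poly w d p).[0] = p.@[w].
  by rewrite horner_line_poly; apply: meval_eq => i; rewrite mulr0 addr0.
rewrite -ev0 -horner_line_poly.
have /eqP/size_poly1P[c _ ->] : size (line_poly w d p) = 1%N.
  apply/eqP; apply: contraT => /closed_rootP[z]; rewrite /root horner_line_poly.
  by rewrite (negPf (p0 z)).
by rewrite !hornerC.
Qed.

End Lines.

(** * Identities for 3 x 3 determinants *)

Definition det3 (k : nzRingType) (a b c a' b' c' a'' b'' c'' : k) :=
  a * (b' * c'' - c' * b'') - b * (a' * c'' - c' * a'')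
  + c * (a' * b'' - b' * a'').

Lemma det3M (k : comNzRingType)
    (a b c a' b' c' a'' b'' c'' x y z x' y' z' x'' y'' z'' : k) :
  det3 a b c a' b' c' a'' b'' c'' * det3 x y z x' y' z' x'' y'' z'' =
  det3 (a * x + b * x' + c * x'') (a * y + b * y' + c * y'')
       (a * z + b * z' + c * z'')
       (a' * x + b' * x' + c' * x'') (a' * y + b' * y' + c' * y'')
       (a' * z + b' * z' + c' * z'')
       (a'' * x + b'' * x' + c'' * x'') (a'' * y + b'' * y' + c'' * y'')
       (a'' * z + b'' * z' + c'' * z'').
Proof. by rewrite /det3; ring. Qed.

Lemma det3_swap (k : comNzRingType) (a b c a' b' c' a'' b'' c'' : k) :
  det3 a' b' c' a b c a'' b'' c'' = - det3 a b c a' b' c' a'' b'' c''.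
Proof. by rewrite /det3; ring. Qed.

Lemma det3_rot (k : comNzRingType) (a b c a' b' c' a'' b'' c'' : k) :
  det3 a'' b'' c'' a b c a' b' c' = det3 a b c a' b' c' a'' b'' c''.
Proof. by rewrite /det3; ring. Qed.

Lemma det3_add_rows (k : comNzRingType) (a b c a' b' c' a'' b'' c'' al be : k) :
  det3 a b c a' b' c' (a'' + (al * a + be * a')) (b'' + (al * b + be * b'))
    (c'' + (al * c + be * c')) = det3 a b c a' b' c' a'' b'' c''.
Proof. by rewrite /det3; ring. Qed.

(** The right-hand sides are the differential of the coordinates of SL_2,
    written through those of three functions F, G, H, and the left-hand sides
    are the coordinates of the fields e, f, h at (x, y, u, v). As e, f, h are
    linearly independent there, the differentials of F, G, H are so too. *)
Lemma det3_factor_neq0 (k : comNzRingType) (x y u v : k) (al be ga : nat -> k)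
    (eF fF hF eG fG hG eH fH hH : k) :
  x * v - y * u = 1 ->
  0 = al 0%N * eF + be 0%N * eG + ga 0%N * eH ->
  0 = al 1%N * eF + be 1%N * eG + ga 1%N * eH ->
  x = al 2%N * eF + be 2%N * eG + ga 2%N * eH ->
  y = al 3%N * eF + be 3%N * eG + ga 3%N * eH ->
  u = al 0%N * fF + be 0%N * fG + ga 0%N * fH ->
  v = al 1%N * fF + be 1%N * fG + ga 1%N * fH ->
  0 = al 2%N * fF + be 2%N * fG + ga 2%N * fH ->
  0 = al 3%N * fF + be 3%N * fG + ga 3%N * fH ->
  x = al 0%N * hF + be 0%N * hG + ga 0%N * hH ->
  y = al 1%N * hF + be 1%N * hG + ga 1%N * hH ->
  - u = al 2%N * hF + be 2%N * hG + ga 2%N * hH ->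
  - v = al 3%N * hF + be 3%N * hG + ga 3%N * hH ->
  det3 eF fF hF eG fG hG eH fH hH != 0.
Proof.
move=> E e0 e1 e2 e3 f0 f1 f2 f3 h0 h1 h2 h3.
(* The covectors dual to e, f, h. *)
pose N (c : nat -> k) :=
  (v * c 2%N - u * c 3%N, x * c 1%N - y * c 0%N, v * c 0%N - u * c 1%N).
suff : det3 (N al).1.1 (N be).1.1 (N ga).1.1 (N al).1.2 (N be).1.2 (N ga).1.2
      (N al).2 (N be).2 (N ga).2 * det3 eF fF hF eG fG hG eH fH hH = 1.
  move=> E1; apply: contraTneq (oner_neq0 k) => J0.
  by rewrite -E1 J0 mulr0 eqxx.
have comb a b (i j : nat) (c c' F G H : k) :
    c = al i * F + be i * G + ga i * H -> c' = al j * F + be j * G + ga j * H ->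
    (a * al i - b * al j) * F + (a * be i - b * be j) * G
      + (a * ga i - b * ga j) * H = a * c - b * c'.
  by move=> -> ->; ring.
rewrite det3M /N/= (comb _ _ _ _ _ _ _ _ _ e2 e3).
rewrite (comb _ _ _ _ _ _ _ _ _ f2 f3) (comb _ _ _ _ _ _ _ _ _ h2 h3).
rewrite (comb _ _ _ _ _ _ _ _ _ e1 e0) (comb _ _ _ _ _ _ _ _ _ f1 f0).
rewrite (comb _ _ _ _ _ _ _ _ _ h1 h0) (comb _ _ _ _ _ _ _ _ _ e0 e1).
rewrite (comb _ _ _ _ _ _ _ _ _ f0 f1) (comb _ _ _ _ _ _ _ _ _ h0 h1).
(* Every term of the determinant has degree 3 in x v - y u. *)
rewrite /det3 -[RHS](expr1n _ 3) -E; ring.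
Qed.

(** The algebra behind divergence_wedge: efG stands for e (f G), and so on. *)
Lemma divergence_identity (k : comNzRingType) (F eF fF hF eG fG hG eH fH hH
    efG feG ehG heG fhG hfG efH feH ehH heH fhH hfH : k) :
  efG = feG + hG -> heG = ehG + 2%:R * eG -> hfG = fhG - 2%:R * fG ->
  efH = feH + hH -> heH = ehH + 2%:R * eH -> hfH = fhH - 2%:R * fH ->
  eF * (fG * hH - hG * fH) +
    F * (efG * hH + fG * ehH - (ehG * fH + hG * efH)) +
  (fF * (hG * eH - eG * hH) +
    F * (fhG * eH + hG * feH - (feG * hH + eG * fhH))) +
  (hF * (eG * fH - fG * eH) +
    F * (heG * fH + eG * hfH - (hfG * eH + fG * heH))) =
  det3 eF fF hF eG fG hG eH fH hH.
Proof. by do 6 move=> ->; rewrite /det3; ring. Qed.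

(** * Regular functions and vector fields on SL_2 *)

Section SL2.
Variable k : closedFieldType.
Let S := affine_sub (@SL2_eq k).
Implicit Types (w : S) (p q : {mpoly k[4]}) (f g : S -> k).

Lemma SL2_quad (x y u v : k) :
  x * v - y * u = 1 -> SL2_eq (\row_i quad x y u v i).
Proof. by rewrite /SL2_eq/= !mxE !quadE. Qed.

Definition sl2_point (x y u v : k) (E : x * v - y * u = 1) : S :=
  SigSub (mem_set (SL2_quad E)).

Lemma peval_sl2_point x y u v (E : x * v - y * u = 1) p :
  peval p (sl2_point E) = p.@[quad x y u v].
Proof. by apply: meval_eq => i; rewrite mxE. Qed.

Definition sl2_coord (j : nat) w : k := val w 0 (inord j).

Lemma sl2_det w :
  sl2_coord 0 w * sl2_coord 3 w - sl2_coord 1 w * sl2_coord 2 w = 1.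
Proof. exact: set_mem (valP w). Qed.

(** The field is linear with square zero, so its flow consists of lines. *)
Lemma tangent_e : tangent (@SL2_eq k) (@sl2_e k).
Proof.
apply: tangent_lines => w s; rewrite /SL2_eq/= /sl2_e !mxE !quadE.
by rewrite meval0 !mevalXU => <-; ring.
Qed.

Lemma tangent_f : tangent (@SL2_eq k) (@sl2_f k).
Proof.
apply: tangent_lines => w s; rewrite /SL2_eq/= /sl2_f !mxE !quadE.
by rewrite meval0 !mevalXU => <-; ring.
Qed.

(** Here h is the commutator of the tangent fields e and f. *)
Lemma tangent_h : tangent (@SL2_eq k) (@sl2_h k).
Proof.
move=> p p0 y; rewrite -sl2_commutator_ef /peval mevalB -!/(peval _ y).
rewrite (tangent_e (tangent_f p0)) (tangent_f (tangent_e p0)).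
by rewrite subrr.
Qed.

Let De := fun_deriv (@sl2_e k) : (S -> k) -> S -> k.
Let Df := fun_deriv (@sl2_f k) : (S -> k) -> S -> k.
Let Dh := fun_deriv (@sl2_h k) : (S -> k) -> S -> k.

(** The coefficient of dF /\ dG /\ dH with respect to the Haar form. *)
Definition jacobian (F G H : S -> k) w :=
  det3 (De F w) (Df F w) (Dh F w) (De G w) (Df G w) (Dh G w)
       (De H w) (Df H w) (Dh H w).

(** The value of dG /\ dH on the pair of fields D1, D2. *)
Definition wedge (D1 D2 : (S -> k) -> S -> k) (G H : S -> k) w :=
  D1 G w * D2 H w - D2 G w * D1 H w.

Lemma jacobian_neq0 (F G H : S -> k) (al be ga : nat -> k) w :
  (forall v j, tangent (@SL2_eq k) v -> (j < 4)%N ->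
     fun_deriv v (sl2_coord j) w =
     al j * fun_deriv v F w + be j * fun_deriv v G w
     + ga j * fun_deriv v H w) ->
  jacobian F G H w != 0.
Proof.
move=> coordE; have coordD v j : tangent (@SL2_eq k) v ->
    fun_deriv v (sl2_coord j) w = peval (v (inord j)) w.
  move=> tv; rewrite -(field_derivX v) -(fun_deriv_poly tv).
  by apply: fun_deriv_eq; apply: nbhs_all => y; rewrite /peval mevalXU.
have e_val : ((peval (@sl2_e k (inord 0)) w = 0) *
    (peval (@sl2_e k (inord 1)) w = 0) *
    (peval (@sl2_e k (inord 2)) w = sl2_coord 0 w) *
    (peval (@sl2_e k (inord 3)) w = sl2_coord 1 w))%type.
  by rewrite /sl2_e !quadE /peval meval0 !mevalXU.
have f_val : ((peval (@sl2_f k (inord 0)) w = sl2_coord 2 w) *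
    (peval (@sl2_f k (inord 1)) w = sl2_coord 3 w) *
    (peval (@sl2_f k (inord 2)) w = 0) *
    (peval (@sl2_f k (inord 3)) w = 0))%type.
  by rewrite /sl2_f !quadE /peval meval0 !mevalXU.
have h_val : ((peval (@sl2_h k (inord 0)) w = sl2_coord 0 w) *
    (peval (@sl2_h k (inord 1)) w = sl2_coord 1 w) *
    (peval (@sl2_h k (inord 2)) w = - sl2_coord 2 w) *
    (peval (@sl2_h k (inord 3)) w = - sl2_coord 3 w))%type.
  by rewrite /sl2_h !quadE /peval !mevalN !mevalXU.
apply: (det3_factor_neq0 (al := al) (be := be) (ga := ga) (sl2_det w));
  rewrite -coordE ?coordD ?e_val ?f_val ?h_val//;
  solve [exact: tangent_e | exact: tangent_f | exact: tangent_h].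
Qed.

(** The formula d (F dG /\ dH) = dF /\ dG /\ dH.  In the expression of the
    exterior derivative by the fields e, f, h, the bracket [e, f] = h
    contributes zero, and the contributions of [h, e] = 2 e and [h, f] = - 2 f
    cancel. *)
Lemma divergence_wedge (F G H : S -> k) w :
  regular_at F w -> regular_at G w -> regular_at H w ->
  De (fun y => F y * wedge Df Dh G H y) w +
  Df (fun y => F y * wedge Dh De G H y) w +
  Dh (fun y => F y * wedge De Df G H y) w = jacobian F G H w.
Proof.
move=> rF rG rH; rewrite /wedge.
have rD v f : tangent (@SL2_eq k) v ->
    regular_at f w -> regular_at (fun_deriv v f) w.
  by move=> tv rf; exact: (regular_at_deriv tv rf).
have te := tangent_e; have tf := tangent_f; have th := tangent_h.
have P1 v a b c d : tangent (@SL2_eq k) v -> regular_at a w -> regular_at b w ->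
    regular_at c w -> regular_at d w ->
    fun_deriv v (fun y => F y * (a y * b y - c y * d y)) w =
    fun_deriv v F w * (a w * b w - c w * d w) +
    F w * (fun_deriv v a w * b w + a w * fun_deriv v b w -
           (fun_deriv v c w * d w + c w * fun_deriv v d w)).
  move=> tv ra rb rc rd; rewrite (fun_derivM tv rF); last first.
    by apply: regular_atB; exact: regular_atM.
  rewrite (fun_derivB tv) ?(fun_derivM tv)//; exact: regular_atM.
rewrite /De /Df /Dh !P1; try solve [assumption|exact: rD].
rewrite -![fun_deriv (@sl2_e k)]/De -![fun_deriv (@sl2_f k)]/Df.
rewrite -![fun_deriv (@sl2_h k)]/Dh.
have ef f : regular_at f w -> De (Df f) w = Df (De f) w + Dh f w.
  move=> rf; have := fun_deriv_commutator te tf th (c := 1) _ rf.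
  rewrite mul1r -/De -/Df -/Dh => <-; first by rewrite addrC subrK.
  by move=> p; rewrite sl2_commutator_ef scale1r.
have he f : regular_at f w -> Dh (De f) w = De (Dh f) w + 2%:R * De f w.
  move=> rf; rewrite -(fun_deriv_commutator th te te (@sl2_commutator_he k) rf).
  by rewrite addrC subrK.
have hf f : regular_at f w -> Dh (Df f) w = Df (Dh f) w - 2%:R * Df f w.
  move=> rf; rewrite -mulNr.
  rewrite -(fun_deriv_commutator th tf tf (@sl2_commutator_hf k) rf).
  by rewrite addrC subrK.
by apply: divergence_identity; auto.
Qed.

(** The ideal of SL_2 is given by a single equation; the quantifier fits the
    hypothesis of regular_everywhere_poly. *)
Lemma SL2_eqP (w : 'rV[k]_4) : SL2_eq w <-> forall p : {mpoly k[4]},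
  p = 'X_(inord 0) * 'X_(inord 3) - 'X_(inord 1) * 'X_(inord 2) - 1 ->
  p.@[fun i => w 0 i] = 0.
Proof.
rewrite /SL2_eq/=; split=> [E p ->|/(_ _ erefl)].
  by rewrite !mevalB !mevalM !mevalXU meval1 E subrr.
by rewrite !mevalB !mevalM !mevalXU meval1 => /eqP; rewrite subr_eq0 => /eqP.
Qed.

Lemma SL2_regular_poly f : has_uncountable_fibres k ->
  (forall w, regular_at f w) -> exists p, forall w, f w = peval p w.
Proof. by move=> unc; exact: (regular_everywhere_poly unc SL2_eqP). Qed.

(** A unit is constant on every line in SL_2, hence invariant under elementary
    row operations, which connect every matrix to the identity. *)
Lemma SL2_unit_cst f : has_uncountable_fibres k ->
  (forall w, regular_at f w) -> (forall w, f w != 0) ->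
  exists2 c, c != 0 & forall w, f w = c.
Proof.
move=> unc /(SL2_regular_poly unc)[p pP] f0.
pose J x y u v := p.@[quad x y u v].
have J0 x y u v : x * v - y * u = 1 -> J x y u v != 0.
  by move=> E; rewrite /J -(peval_sl2_point E) -pP.
have addq (x y u v x' y' u' v' s : k) i :
    quad x y u v i + quad x' y' u' v' i * s =
    quad (x + x' * s) (y + y' * s) (u + u' * s) (v + v' * s) i.
  by move: i; apply: ord4P; rewrite !quadE.
have Je x y u v s : x * v - y * u = 1 ->
    J x y (u + x * s) (v + y * s) = J x y u v.
  move=> E; rewrite /J -[RHS](@nonvanishing_line _ _ p _ (quad 0 0 x y) _ s).
    by apply: meval_eq => i; rewrite addq !mul0r !addr0.
  move=> t; rewrite (@meval_eq _ _ _ _ _ (addq _ _ _ _ _ _ _ _ _)).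
  by apply: J0; rewrite !mul0r !addr0 -E; ring.
have Jf x y u v s : x * v - y * u = 1 ->
    J (x + u * s) (y + v * s) u v = J x y u v.
  move=> E; rewrite /J -[RHS](@nonvanishing_line _ _ p _ (quad u v 0 0) _ s).
    by apply: meval_eq => i; rewrite addq !mul0r !addr0.
  move=> t; rewrite (@meval_eq _ _ _ _ _ (addq _ _ _ _ _ _ _ _ _)).
  by apply: J0; rewrite !mul0r !addr0 -E; ring.
have Ju x y u v : x * v - y * u = 1 -> u != 0 -> J x y u v = J 1 0 0 1.
  move=> E u0; rewrite -(Jf _ _ _ _ ((1 - x) / u) E).
  have -> : x + u * ((1 - x) / u) = 1 by field.
  set y' := y + _; have E' : 1 * v - y' * u = 1 by rewrite -[RHS]E /y'; field.
  rewrite -(Je _ _ _ _ (- u) E') mul1r subrr.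
  have -> : v + y' * - u = 1 by rewrite -[RHS]E'; ring.
  have E1 : 1 * 1 - 0 * 0 = 1 :> k by ring.
  by rewrite -(Jf _ _ _ _ y' E1) mul0r mul1r addr0 add0r.
exists (J 1 0 0 1); first by apply: J0; rewrite !mul0r mul1r subr0.
move=> w; rewrite pP; have E := sl2_det w.
have -> : peval p w =
    J (sl2_coord 0 w) (sl2_coord 1 w) (sl2_coord 2 w) (sl2_coord 3 w).
  by apply: meval_eq; apply: ord4P; rewrite quadE.
have [u0|/Ju->//] := eqVneq (sl2_coord 2 w) 0.
rewrite -(Je _ _ _ _ 1 E); apply: Ju.
  by rewrite -[RHS]E; ring.
rewrite u0 add0r mulr1; apply: contraTneq (oner_neq0 k) => x0.
by rewrite -E u0 x0 mul0r mulr0 subrr eqxx.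
Qed.

(** The left-hand side has integral zero by torus_average_e, torus_average_f and
    torus_average_h, while c has integral c. *)
Lemma SL2_no_constant_divergence (f1 f2 f3 : S -> k) c :
  has_uncountable_fibres k -> [pchar k] =i pred0 ->
  (forall w, regular_at f1 w) -> (forall w, regular_at f2 w) ->
  (forall w, regular_at f3 w) ->
  (forall w, De f1 w + Df f2 w + Dh f3 w = c) -> c = 0.
Proof.
move=> unc ch0 /(SL2_regular_poly unc)[p1 /funext ->].
move=> /(SL2_regular_poly unc)[p2 /funext ->].
move=> /(SL2_regular_poly unc)[p3 /funext ->].
move=> E; pose d := field_deriv (@sl2_e k) p1 + field_deriv (@sl2_f k) p2
  + field_deriv (@sl2_h k) p3.
have dE : torus_average d = c%:P.
  rewrite -torus_averageC -[d](subrK c%:MP) torus_averageD.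
  rewrite [X in X + _]torus_average_eq0 ?add0r// => x y u v det1.
  rewrite -(peval_sl2_point det1) /peval mevalB mevalC /d !mevalD.
  have := E (sl2_point det1); rewrite /De /Df /Dh.
  rewrite (fun_deriv_poly tangent_e) (fun_deriv_poly tangent_f).
  by rewrite (fun_deriv_poly tangent_h) => <-; rewrite subrr.
apply: (exact_on_segment_const ch0); rewrite -dE /d !torus_averageD.
apply: exact_on_segmentD; first apply: exact_on_segmentD.
- exact: torus_average_e.
- exact: torus_average_f.
- exact: torus_average_h.
Qed.

End SL2.

(** * Morphisms into affine sets *)

Section Morphisms.
Variables (k : closedFieldType).

Lemma morphism_on_comp (X Y Z : fun_space k) (U : set X) (V : set Y)
    (phi : X -> Y) (chi : Y -> Z) :
  morphism_on U phi -> morphism_on V chi ->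
  morphism_on (U `&` phi @^-1` V) (chi \o phi).
Proof.
move=> mphi mchi W oW; have [oVW rVW] := mchi W oW; have [oU rU] := mphi _ oVW.
have E : U `&` phi @^-1` V `&` (chi \o phi) @^-1` W =
         U `&` phi @^-1` (V `&` chi @^-1` W) by rewrite -setIA.
by rewrite E; split=> // f /rVW/rU.
Qed.

Lemma morphism_on_open (X Y : fun_space k) (U : set X) (phi : X -> Y) :
  morphism_on U phi -> open U.
Proof. by move=> /(_ setT openT)[]; rewrite preimage_setT setIT. Qed.

Lemma morphism_on_nbhs (X Y : fun_space k) (U : set X) (phi : X -> Y) x
    (N : set Y) :
  morphism_on U phi -> U x -> nbhs (phi x) N ->
  nbhs x (fun y => U y /\ N (phi y)).
Proof.
move=> mphi Ux; rewrite nbhsE => -[V [oV Vx] VN].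
have [oUV _] := mphi V oV; rewrite nbhsE.
exists (U `&` phi @^-1` V); first by split.
by move=> y [Uy /VN].
Qed.

Lemma sub_space_regular_at n (A : set 'rV[k]_n) (U : set (sub_space A)) f x :
  regular U f -> U x -> regular_at f x.
Proof. by move=> rf Ux; exact: rf. Qed.

Lemma coord_regular n (A : set 'rV[k]_n) i (U : set (sub_space A)) :
  regular U (fun x : sub_space A => val x 0 i).
Proof.
move=> x _; apply: regular_at_eq (regular_at_poly 'X_i x).
by apply: nbhs_all => y; rewrite /peval mevalXU.
Qed.

Section IntoSubspace.
Variables (n m : nat) (A : set 'rV[k]_n) (A' : set 'rV[k]_m).
Variables (U : set (sub_space A)) (c : sub_space A -> sub_space A').
Hypothesis mc : morphism_on U c.

Lemma regular_at_coord_comp x i : U x -> regular_at (fun y => val (c y) 0 i) x.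
Proof.
move=> Ux; have [_ /(_ _ (@coord_regular _ _ i setT))] := mc openT.
by move=> /(sub_space_regular_at (x := x)); apply.
Qed.

Lemma regular_at_pullback (g : sub_space A' -> k) x :
  U x -> regular_at g (c x) -> regular_at (g \o c) x.
Proof.
move=> Ux rg; have : nbhs (c x) (regular_at g) by exact: regular_at_near.
rewrite nbhsE => -[V [oV Vc] Vg].
have [_ /(_ g)] := mc oV.
have rV : regular V g by move=> y /Vg.
by move=> /(_ rV)/(sub_space_regular_at (x := x)); apply.
Qed.

Lemma fun_deriv_pullback (g : sub_space A' -> k) p q x :
  U x -> local_frac g p q (c x) ->
  forall v, tangent A v -> fun_deriv v (g \o c) x =
    \sum_i fun_deriv v (fun y => val (c y) 0 i) x *
           frac_partial p q (fun i => val (c x) 0 i) i.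
Proof.
move=> Ux gpq v tv.
apply: (fun_deriv_comp_frac tv (F := fun i y => val (c y) 0 i)).
- by move=> i; exact: regular_at_coord_comp.
- by apply: regular_at_pullback => //; exists p, q.
- by apply: (nbhs_mono (morphism_on_nbhs mc Ux gpq)) => y [].
Qed.

End IntoSubspace.
End Morphisms.

(** * Fibre coordinates of a trivialization *)

Section FibreCoordinate.
Variables (k : closedFieldType) (n : nat) (A : set 'rV[k]_n) (P : Ga_bundle A).
Variables (W : set (sub_space A))
  (Phi : total_space P -> sub_space (cylinder A))
  (Psi : sub_space (cylinder A) -> total_space P).
Let XW := @bundle_proj _ _ _ P @^-1` W.
Hypothesis PsiK : forall x, XW x -> Psi (Phi x) = x.
Hypothesis PhiB : forall x, XW x -> cyl_base (Phi x) = val (bundle_proj x).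
Hypothesis PhiF : forall a x, XW x ->
  cyl_fiber (Phi (Ga_act a x)) = a + cyl_fiber (Phi x).

Lemma cylinder_ext (z z' : sub_space (cylinder A)) :
  cyl_base z = cyl_base z' -> cyl_fiber z = cyl_fiber z' -> z = z'.
Proof.
move=> zb zf; apply: val_inj; rewrite -[LHS]hsubmxK -[RHS]hsubmxK.
congr row_mx; first exact: zb.
by apply/rowP => i; rewrite ord1; exact: zf.
Qed.

Lemma act_fibre_difference x x' : XW x -> bundle_proj x' = bundle_proj x ->
  Ga_act (cyl_fiber (Phi x') - cyl_fiber (Phi x)) x = x'.
Proof.
move=> Xx xx'; have Xx' : XW x' by rewrite /XW/= xx'.
set a := _ - _; have Xa : XW (Ga_act a x) by rewrite /XW/= proj_Ga_act.
rewrite -(PsiK Xa) -[RHS](PsiK Xx'); congr Psi; apply: cylinder_ext.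
  by rewrite !PhiB// proj_Ga_act xx'.
by rewrite PhiF// /a subrK.
Qed.

Lemma act_inj_fibre a x x' : XW x -> Ga_act a x = x' ->
  a = cyl_fiber (Phi x') - cyl_fiber (Phi x).
Proof. by move=> Xx <-; rewrite PhiF// addrK. Qed.

End FibreCoordinate.

(** * Euler's identity *)

(** The identity p ((1 + t) b) (1 + t)^d = g(b) q ((1 + t) b), which homogeneity
    gives for all but finitely many t, is differentiated at t = 0. *)
Lemma Euler_homogeneous (k : closedFieldType) d
    (V : set (sub_space (A2star k))) (g : sub_space (A2star k) -> k)
    (p q : {mpoly k[2]}) (b : sub_space (A2star k)) :
  Gm_stable V -> homogeneous_on d V g -> V b -> local_frac g p q b ->
  \sum_i val b 0 i * frac_partial p q (fun i => val b 0 i) i = - (d%:R * g b).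
Proof.
move=> sV hg Vb gpq; have [q0 gb] := nbhs_at gpq.
have [r [rb rP]] := (nbhs_zariski _ _).1 gpq.
pose w i := val b 0 i; pose L s := line_poly w w s.
have LE s t : (L s).[t] = s.@[fun i => (1 + t) * w i].
  by rewrite horner_line_poly; apply: meval_eq => i; ring.
have ev0 s : (L s).[0] = peval s b.
  by rewrite LE /peval; apply: meval_eq => i; rewrite addr0 mul1r.
pose F := L p * (1 + 'X) ^+ d - g b *: L q.
(* The factor L r restricts to the t where p / q represents g at (1 + t) b, and
   1 + 'X excludes the origin. *)
have : L r * F * (1 + 'X) = 0.
  apply: horner_eq0_poly0 => t.
  rewrite 2!hornerM [(1 + 'X).[t]]hornerD hornerC hornerX.
  have [->|t0] := eqVneq (1 + t) 0; first by rewrite mulr0.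
  have nz : A2star k ((1 + t) *: val b).
    rewrite /A2star/= scaler_eq0 (negPf t0)/=.
    exact: set_mem (valP b).
  pose y : sub_space (A2star k) := SigSub (mem_set nz).
  have yE s : peval s y = (L s).[t].
    by rewrite LE; apply: meval_eq => i; rewrite /= mxE.
  have [Lr0|Lr0] := eqVneq (L r).[t] 0; first by rewrite Lr0 !mul0r.
  have := rP y; rewrite yE => /(_ Lr0)[qy gy].
  have := hg b y _ t0 erefl Vb; rewrite gy => E.
  suff -> : F.[t] = 0 by rewrite mulr0 mul0r.
  rewrite /F hornerD hornerN hornerZ hornerM horner_exp hornerD hornerC hornerX.
  rewrite -!yE; have -> : peval p y = (1 + t) ^- d * g b * peval q y.
    by rewrite -E mulfVK.
  by field; rewrite expf_neq0.
move/eqP; rewrite mulf_eq0 [1 + 'X == 0]negbTE ?orbF; last first.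
  apply/eqP => /(congr1 (fun u : {poly k} => u.[0])) /eqP.
  by rewrite hornerD hornerC hornerX addr0 horner0 oner_eq0.
rewrite mulf_eq0 => /orP[/eqP Lr0|/eqP F0].
  by move: rb; rewrite -ev0 Lr0 horner0 eqxx.
have := congr1 (fun u : {poly k} => u^`().[0]) F0.
rewrite /F derivB derivM deriv_exp derivD derivC derivX add0r derivZ deriv0.
rewrite !(hornerD, hornerN, hornerM, hornerZ, hornerMn, horner_exp).
rewrite !hornerC hornerX addr0 !expr1n !deriv_line_poly ev0 ?horner0.
set Ep := \sum_i _; set Eq := \sum_i _ => E.
have -> : \sum_i val b 0 i * frac_partial p q (fun i0 => val b 0 i0) i =
    (Ep * peval q b - peval p b * Eq) / peval q b ^+ 2.
  rewrite big_distrl big_distrr -sumrB big_distrl; apply: eq_bigr => i _ /=.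
  by rewrite /frac_partial /peval /w; ring.
have EpE : Ep = g b * Eq - peval p b * d%:R.
  by apply/eqP; rewrite -subr_eq0 -[X in _ == X]E; apply/eqP; ring.
by rewrite EpE gb; field.
Qed.

(** * Homogeneous bundles with total space SL_2 *)

Section BundleOnSL2.
Variables (k : closedFieldType) (d : nat) (P : Ga_bundle (A2star k)).
Variables (phi : total_space P -> X11 k) (psi : X11 k -> total_space P).
Hypotheses (mphi : morphism_on setT phi) (mpsi : morphism_on setT psi).
Hypothesis psiK : cancel psi phi.
Variables (T : Type) (U : T -> set (sub_space (A2star k)))
  (g : T -> T -> sub_space (A2star k) -> k).
Hypothesis Ucover : open_cover U.
Hypothesis Ustable : forall i, Gm_stable (U i).
Hypothesis gcocycle : cech_cocycle U g.
Hypothesis ghom : forall i j, homogeneous_on d (U i `&` U j) (g i j).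
Variable s : T -> sub_space (A2star k) -> total_space P.
Hypothesis ssection : forall i, section_on (U i) (s i).
Hypothesis stransition : forall i j b, U i b -> U j b ->
  Ga_act (g i j b) (s i b) = s j b.

Let S := affine_sub (@SL2_eq k).
Let rho := @bundle_proj _ _ _ P.

Definition base_map : X11 k -> sub_space (A2star k) := rho \o psi.
Let r := base_map.

Definition base_coord (j : 'I_2) : S -> k := fun w => val (r w) 0 j.

(** The coordinate of the fibres for which the i-th section is zero. *)
Definition fibre_coord (i : T) : S -> k := fun w =>
  xget 0 [set a | psi w = Ga_act a (s i (r w))].

Let F := base_coord ord0.
Let G := base_coord ord_max.
Let t := fibre_coord.

Lemma base_map_morphism : morphism_on setT r.
Proof.
have := morphism_on_comp mpsi (@proj_morphism _ _ _ P).
by rewrite preimage_setT setIT.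
Qed.

Lemma base_coord_regular j w : regular_at (base_coord j) w.
Proof. exact: (regular_at_coord_comp base_map_morphism). Qed.

Lemma near_cover i w : U i (r w) -> nbhs w (fun y => U i (r y)).
Proof.
move=> Uiw; have oU := Ucover.1 i.
have /(morphism_on_nbhs base_map_morphism I)H : nbhs (r w) (U i).
  by rewrite nbhsE; exists (U i).
by apply: (nbhs_mono H) => y [].
Qed.

Lemma fibre_coordE i w W
    (Phi : total_space P -> sub_space (cylinder (A2star k)))
    (Psi : sub_space (cylinder (A2star k)) -> total_space P) :
  (forall x, (rho @^-1` W) x -> Psi (Phi x) = x) ->
  (forall x, (rho @^-1` W) x -> cyl_base (Phi x) = val (rho x)) ->
  (forall a x, (rho @^-1` W) x ->
     cyl_fiber (Phi (Ga_act a x)) = a + cyl_fiber (Phi x)) ->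
  U i (r w) -> W (r w) ->
  t i w = cyl_fiber (Phi (psi w)) - cyl_fiber (Phi (s i (r w))).
Proof.
move=> PsiK PhiB PhiF Uiw Ww; have [_ /(_ _ Uiw) sr] := ssection i.
have Xs : (rho @^-1` W) (s i (r w)) by rewrite /rho/= sr.
rewrite /t /fibre_coord; apply: xget_unique => /=.
  by rewrite (act_fibre_difference PsiK PhiB PhiF Xs).
by move=> a E; apply: (act_inj_fibre PhiF Xs); rewrite E.
Qed.

Lemma fibre_coord_transition i j w : U i (r w) -> U j (r w) ->
  t i w = t j w + g i j (r w).
Proof.
move=> Ui Uj; have [W [_ Ww triv]] := @locally_trivial _ _ _ P (r w).
have [Phi [Psi [_ [XP _] PB PF]]] := triv.
have PsiK x : (rho @^-1` W) x -> Psi (Phi x) = x by move=> /XP[].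
rewrite !(fibre_coordE PsiK PB PF)// -(stransition Ui Uj) PF.
  by ring.
by have [_ sr] := ssection i; rewrite /rho/= sr.
Qed.

Lemma fun_deriv_from_base (h : sub_space (A2star k) -> k) p q w :
  local_frac h p q (r w) -> forall v, tangent (@SL2_eq k) v ->
  fun_deriv v (h \o r) w =
    fun_deriv v F w * frac_partial p q (fun i => val (r w) 0 i) ord0 +
    fun_deriv v G w * frac_partial p q (fun i => val (r w) 0 i) ord_max.
Proof.
move=> hpq v tv; rewrite (fun_deriv_pullback base_map_morphism I hpq tv).
rewrite big_ord_recl big_ord1.
by have -> : lift ord0 ord0 = ord_max :> 'I_2 by apply/val_inj.
Qed.

(** In a trivialization, t_i is the fibre coordinate tau minus the value sg of
    tau on the i-th section, and the coordinates of SL_2 are locally rational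
    functions of the coordinates of the base and of tau. *)
Lemma fibre_coord_local i w : U i (r w) ->
  regular_at (t i) w /\ exists al be ga : nat -> k, forall v j,
    tangent (@SL2_eq k) v -> (j < 4)%N -> fun_deriv v (sl2_coord j) w =
     al j * fun_deriv v F w + be j * fun_deriv v G w
     + ga j * fun_deriv v (t i) w.
Proof.
move=> Ui; have [W [oW Ww [Phi [Psi]]]] := @locally_trivial _ _ _ P (r w).
set XW := @bundle_proj _ _ _ P @^-1` W; set CW := [set z | _].
move=> [[mPhi mPsi] [XP CP] PB PF].
have PsiK x : XW x -> Psi (Phi x) = x by move=> /XP[].
pose c : X11 k -> sub_space (cylinder (A2star k)) := Phi \o psi.
pose Wr := r @^-1` W.
have mc : morphism_on Wr c.
  by have := morphism_on_comp mpsi mPhi; rewrite setTI.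
pose tau : S -> k := fun y => val (c y) 0 (rshift 2 ord0).
have tauE y : tau y = cyl_fiber (c y) by rewrite /cyl_fiber mxE.
pose sg : sub_space (A2star k) -> k :=
  fun b => val (Phi (s i b)) 0 (rshift 2 ord0).
have msg : morphism_on (U i `&` s i @^-1` XW) (Phi \o s i).
  by apply: morphism_on_comp => //; have [] := ssection i.
have sr b : U i b -> rho (s i b) = b by have [_] := ssection i; exact.
have rsg : regular_at sg (r w).
  by apply: (regular_at_coord_comp msg); split=> //; rewrite /XW/= -/rho sr.
have nW : nbhs w Wr.
  by rewrite nbhsE; exists Wr => //; split=> //; exact: morphism_on_open mc.
have tE : nbhs w (fun y => t i y = tau y - (sg \o r) y).
  apply: (nbhs_mono (nbhs_setI (near_cover Ui) nW)) => y [Uy Wy].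
  rewrite (fibre_coordE PsiK PB PF)// tauE; congr (_ - _).
  by rewrite /cyl_fiber mxE.
have rtau : regular_at tau w by exact: (regular_at_coord_comp mc).
have rsgr : regular_at (sg \o r) w.
  exact: (regular_at_pullback base_map_morphism).
have rt : regular_at (t i) w.
  apply: regular_at_eq (regular_atB rtau rsgr).
  by apply: (nbhs_mono tE) => y ->.
split=> //.
have [p [q sgpq]] := rsg.
have tD v : tangent (@SL2_eq k) v -> fun_deriv v tau w =
    fun_deriv v (t i) w + fun_deriv v (sg \o r) w.
  by move=> tv; rewrite (fun_deriv_eq v tE) (fun_derivB tv)// subrK.
have CWw : CW (c w) by exact: (XP _ Ww).1.
pose y j : sub_space (cylinder (A2star k)) -> k :=
  @sl2_coord k j \o (phi \o Psi).
have ry j : regular_at (y j) (c w).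
  have mm : morphism_on CW (phi \o Psi).
    by have := morphism_on_comp mPsi mphi; rewrite preimage_setT setIT.
  exact: (regular_at_coord_comp mm).
have /choice[yp ypP] : forall j,
    exists pq : {mpoly k[2 + 1]} * {mpoly k[2 + 1]},
    local_frac (y j) pq.1 pq.2 (c w).
  by move=> j; have [p' [q' ?]] := ry j; exists (p', q').
pose fp j i := frac_partial (yp j).1 (yp j).2 (fun i => val (c w) 0 i) i.
pose a0 := frac_partial p q (fun i => val (r w) 0 i).
exists (fun j => fp j (lshift 1 ord0) + fp j (rshift 2 ord0) * a0 ord0),
  (fun j => fp j (lshift 1 ord_max) + fp j (rshift 2 ord0) * a0 ord_max),
  (fun j => fp j (rshift 2 ord0)) => v j tv j4.
have -> : fun_deriv v (sl2_coord j) w = fun_deriv v (y j \o c) w.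
  apply: fun_deriv_eq; apply: (nbhs_mono nW) => z Wz.
  by rewrite /y /c /= PsiK// psiK.
rewrite (fun_deriv_pullback mc Ww (ypP j) tv) big_split_ord/= big_ord1.
have baseE l : fun_deriv v (fun z => val (c z) 0 (lshift 1 l)) w =
    fun_deriv v (base_coord l) w.
  apply: fun_deriv_eq; apply: (nbhs_mono nW) => z Wz.
  by have /(congr1 (fun M : 'rV_2 => M 0 l)) := PB _ Wz; rewrite mxE.
rewrite big_ord_recl big_ord1 !baseE.
have -> : lift ord0 ord0 = ord_max :> 'I_2 by apply/val_inj.
have := tD v tv; rewrite (fun_deriv_from_base sgpq tv) -/a0.
rewrite -/F -/G -!/(fp j _) => tauD.
rewrite -/tau tauD; ring.
Qed.

(** With al and be the partial derivatives of g_ij, the last equation is Euler's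
    identity. *)
Lemma fibre_coord_transition_deriv i j w : U i (r w) -> U j (r w) ->
  exists al be, (forall v, tangent (@SL2_eq k) v ->
    fun_deriv v (t i) w =
      fun_deriv v (t j) w + (al * fun_deriv v F w + be * fun_deriv v G w)) /\
    F w * al + G w * be = - (d%:R * (t i w - t j w)).
Proof.
move=> Ui Uj; have Uij : (U i `&` U j) (r w) by split.
have [p [q gpq]] := sub_space_regular_at (gcocycle.1 i j) Uij.
pose a := frac_partial p q (fun l => val (r w) 0 l).
exists (a ord0), (a ord_max); split.
  move=> v tv; have rgr : regular_at (g i j \o r) w.
    by apply: (regular_at_pullback base_map_morphism) => //; exists p, q.
  rewrite (@fun_deriv_eq _ _ _ v _ (fun y => t j y + (g i j \o r) y)).
    rewrite (fun_derivD tv (fibre_coord_local Uj).1 rgr).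
    by rewrite (fun_deriv_from_base gpq tv) /a; ring.
  apply: (nbhs_mono (nbhs_setI (near_cover Ui) (near_cover Uj))) => y [Uiy Ujy].
  by rewrite (fibre_coord_transition Uiy Ujy).
have sU : Gm_stable (U i `&` U j).
  move=> b c l l0 cb [Uib Ujb].
  by split; [apply: Ustable cb Uib|apply: Ustable cb Ujb].
have := Euler_homogeneous sU (@ghom i j) Uij gpq.
rewrite big_ord_recl big_ord1.
have -> : lift ord0 ord0 = ord_max :> 'I_2 by apply/val_inj.
by rewrite (fibre_coord_transition Ui Uj) => ->; ring.
Qed.

Lemma jacobian_transition i j w : U i (r w) -> U j (r w) ->
  jacobian F G (t i) w = jacobian F G (t j) w.
Proof.
move=> Ui Uj; have [al [be [tD _]]] := fibre_coord_transition_deriv Ui Uj.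
rewrite /jacobian (tD _ (@tangent_e k)) (tD _ (@tangent_f k)).
rewrite (tD _ (@tangent_h k)).
exact: det3_add_rows.
Qed.

(** The contraction of dF /\ dG /\ dH with the vector field E such that E F = F,
    E G = G and E H = - d H, evaluated on the pair of fields v1, v2. *)
Definition contraction (v1 v2 : 'I_4 -> {mpoly k[4]}) (H : S -> k) w : k :=
  F w * wedge (fun_deriv v1) (fun_deriv v2) G H w -
  G w * wedge (fun_deriv v1) (fun_deriv v2) F H w -
  d%:R * (H w * wedge (fun_deriv v1) (fun_deriv v2) F G w).

Lemma contraction_transition v1 v2 i j w :
  tangent (@SL2_eq k) v1 -> tangent (@SL2_eq k) v2 -> U i (r w) -> U j (r w) ->
  contraction v1 v2 (t i) w = contraction v1 v2 (t j) w.
Proof.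
move=> tv1 tv2 Ui Uj.
have [al [be [tD E]]] := fibre_coord_transition_deriv Ui Uj.
rewrite /contraction /wedge !tD//.
have -> : d%:R * (t i w * (fun_deriv v1 F w * fun_deriv v2 G w -
    fun_deriv v2 F w * fun_deriv v1 G w)) =
  (d%:R * t j w - (F w * al + G w * be)) *
    (fun_deriv v1 F w * fun_deriv v2 G w -
     fun_deriv v2 F w * fun_deriv v1 G w) by rewrite E; ring.
by ring.
Qed.

Lemma jacobian_regular i w : U i (r w) -> regular_at (jacobian F G (t i)) w.
Proof.
move=> Ui; have [rt _] := fibre_coord_local Ui.
have rF := base_coord_regular ord0 w; have rG := base_coord_regular ord_max w.
have rD v f : tangent (@SL2_eq k) v ->
    regular_at f w -> regular_at (fun_deriv v f) w.
  by move=> tv rf; exact: (regular_at_deriv tv rf).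
have te := @tangent_e k; have tf := @tangent_f k; have th := @tangent_h k.
rewrite /jacobian /det3.
by repeat first [apply: regular_atB|apply: regular_atD|apply: regular_atM
  |apply: rD].
Qed.

Lemma contraction_regular v1 v2 i w : tangent (@SL2_eq k) v1 ->
  tangent (@SL2_eq k) v2 -> U i (r w) -> regular_at (contraction v1 v2 (t i)) w.
Proof.
move=> tv1 tv2 Ui; have [rt _] := fibre_coord_local Ui.
have rF := base_coord_regular ord0 w; have rG := base_coord_regular ord_max w.
have rD v f : tangent (@SL2_eq k) v ->
    regular_at f w -> regular_at (fun_deriv v f) w.
  by move=> tv rf; exact: (regular_at_deriv tv rf).
rewrite /contraction /wedge.
by repeat first [apply: regular_atB|apply: regular_atD|apply: regular_atM
  |apply: regular_at_cst|apply: rD].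
Qed.

Lemma contraction_deriv v v1 v2 i w : tangent (@SL2_eq k) v ->
  tangent (@SL2_eq k) v1 -> tangent (@SL2_eq k) v2 -> U i (r w) ->
  fun_deriv v (contraction v1 v2 (t i)) w =
  fun_deriv v (fun y => F y * wedge (fun_deriv v1) (fun_deriv v2) G (t i) y) w -
  fun_deriv v (fun y => G y * wedge (fun_deriv v1) (fun_deriv v2) F (t i) y) w -
  d%:R * fun_deriv v
    (fun y => t i y * wedge (fun_deriv v1) (fun_deriv v2) F G y) w.
Proof.
move=> tv tv1 tv2 Ui; have [rt _] := fibre_coord_local Ui.
have rF := base_coord_regular ord0 w; have rG := base_coord_regular ord_max w.
have rW f h l : regular_at f w -> regular_at h w -> regular_at l w ->
    regular_at (fun y => f y * wedge (fun_deriv v1) (fun_deriv v2) h l y) w.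
  move=> rf rh rl; apply: regular_atM => //.
  by apply: regular_atB; apply: regular_atM; apply: regular_at_deriv.
rewrite /contraction (fun_derivB tv); first last.
- by apply: regular_atM; [exact: regular_at_cst|exact: rW].
- by apply: regular_atB; exact: rW.
rewrite (fun_derivB tv); [|exact: rW..].
rewrite (fun_derivM tv (regular_at_cst _ _)); last exact: rW.
by rewrite (fun_deriv_cst tv) mul0r add0r.
Qed.

(** The forms dF /\ dG /\ dt_i and their contractions glue to mu and eta on
    SL_2, and d eta = (2 - d) mu with mu a nonzero constant multiple c of the
    Haar form. *)
Lemma degree_eq2 : has_uncountable_fibres k -> [pchar k] =i pred0 ->
  2%:R - d%:R = 0 :> k.
Proof.
move=> unc ch0.
have te := @tangent_e k; have tf := @tangent_f k; have th := @tangent_h k.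
have /choice[ix ixP] : forall w, exists i, U i (r w).
  by move=> w; exact: Ucover.2.
(* The coefficient of mu; ix picks a member of the cover around each point. *)
pose J w := jacobian F G (t (ix w)) w.
have JE i w : U i (r w) -> J w = jacobian F G (t i) w.
  by move=> Ui; exact: jacobian_transition.
have near_eq (f : S -> k) (h : T -> S -> k) :
    (forall i w, U i (r w) -> f w = h i w) ->
    forall i w, U i (r w) -> nbhs w (fun y => f y = h i y).
  by move=> fh i w Ui; apply: (nbhs_mono (near_cover Ui)) => y /fh.
have Jr w : regular_at J w.
  apply: regular_at_eq (jacobian_regular (ixP w)).
  by apply: (nbhs_mono (near_eq _ _ JE _ _ (ixP w))) => y ->.
have J0 w : J w != 0.
  have [_ [al [be [ga coordE]]]] := fibre_coord_local (ixP w).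
  exact: jacobian_neq0 coordE.
have [c c0 Jc] := SL2_unit_cst unc Jr J0.
(* The coefficients of eta. *)
pose K v1 v2 w := contraction v1 v2 (t (ix w)) w.
have KE v1 v2 : tangent (@SL2_eq k) v1 -> tangent (@SL2_eq k) v2 ->
    forall i w, U i (r w) -> K v1 v2 w = contraction v1 v2 (t i) w.
  by move=> tv1 tv2 i w Ui; exact: contraction_transition.
have Kr v1 v2 w : tangent (@SL2_eq k) v1 -> tangent (@SL2_eq k) v2 ->
    regular_at (K v1 v2) w.
  move=> tv1 tv2; apply: regular_at_eq (contraction_regular tv1 tv2 (ixP w)).
  by apply: (nbhs_mono (near_eq _ _ (KE _ _ tv1 tv2) _ _ (ixP w))) => y ->.
have KD v v1 v2 w : tangent (@SL2_eq k) v1 -> tangent (@SL2_eq k) v2 ->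
    fun_deriv v (K v1 v2) w = fun_deriv v (contraction v1 v2 (t (ix w))) w.
  move=> tv1 tv2; apply: fun_deriv_eq.
  exact: near_eq (KE _ _ tv1 tv2) _ _ (ixP w).
apply/eqP; have : (2%:R - d%:R) * c = 0.
  apply: (SL2_no_constant_divergence (f1 := K (@sl2_f k) (@sl2_h k))
    (f2 := K (@sl2_h k) (@sl2_e k)) (f3 := K (@sl2_e k) (@sl2_f k)) unc ch0).
  - by move=> w; exact: Kr.
  - by move=> w; exact: Kr.
  - by move=> w; exact: Kr.
  move=> w; rewrite !KD//.
  rewrite !(contraction_deriv _ _ _ (ixP w))//.
  have [rt _] := fibre_coord_local (ixP w).
  have rF := base_coord_regular ord0 w; have rG := base_coord_regular ord_max w.
  have E1 := divergence_wedge rF rG rt; have E2 := divergence_wedge rG rF rt.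
  have E3 := divergence_wedge rt rF rG.
  have E2' : jacobian G F (t (ix w)) w = - J w by exact: det3_swap.
  have E3' : jacobian (t (ix w)) F G w = J w by exact: det3_rot.
  have regroup (a1 a2 a3 b1 b2 b3 c1 c2 c3 l : k) :
      a1 - b1 - l * c1 + (a2 - b2 - l * c2) + (a3 - b3 - l * c3) =
      a1 + a2 + a3 - (b1 + b2 + b3) - l * (c1 + c2 + c3) by ring.
  rewrite -(Jc w).
  have -> : (2%:R - d%:R) * J w = J w - (- J w) - d%:R * J w by ring.
  rewrite -E2' -{2}E3' [J w]/J -E1 -E2 -E3; exact: regroup.
by move/eqP; rewrite mulf_eq0 (negPf c0) orbF.
Qed.

End BundleOnSL2.

Theorem corollary2p6 (R : realType) (d : nat) (hd : (2 < d)%N)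
    (P : Ga_bundle (A2star R[i])) (hP : homogeneous_bundle d P) :
  ~ isomorphic (total_space P) (X11 R[i]).
Proof.
move=> [phi [psi [mphi mpsi _ psiK]]].
have [_ _ [T [U [g [[cov st] coc hom [s [sec tr]]]]]]] := hP.
have ch0 : [pchar R[i]] =i pred0 by exact: pchar_num.
have /eqP := degree_eq2 mphi mpsi psiK cov st coc hom sec tr
  (@complex_uncountable R) ch0.
by rewrite subr_eq0 eqr_nat => /eqP d2; move: hd; rewrite -d2.
Qed.
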